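(* For every integer $d\geq1$, \[ \alpha_{\mathbb{C}}(d) \geq \frac8{3\pi} - \frac4d \qquad\text{and}\qquad \alpha_{\mathbb{R}}(d) \geq \frac8{3\pi} - 3 \sqrt{\frac1{d}}- \frac4d. \]
   Context: Let $G_{\mathbb{R}}\in\mathbb{R}^{d\times d}$ have i.i.d. real $\mathcal{N}(0,d^{-1})$ entries and $G_{\mathbb{C}}\in\mathbb{C}^{d\times d}$ i.i.d. circularly symmetric complex Gaussian entries with $\mathbb{E}|z|^2=d^{-1}$. Define $\alpha_{\mathbb{R}}(d)=\mathbb{E}\left[\frac1d\sum_{j=1}^d\sigma_j(G_{\mathbb{R}})\right]$ and $\alpha_{\mathbb{C}}(d)=\mathbb{E}\left[\frac1d\sum_{j=1}^d\sigma_j(G_{\mathbb{C}})\right]$, where $\sigma_j$ is the $j$-th singular value. *)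

(* Defs.v *)
From HB Require Import structures.
From mathcomp Require Import all_boot all_order all_algebra.
From mathcomp Require Import spectral.
From mathcomp Require Import complex.
From mathcomp Require Import all_classical all_reals all_analysis.

Set Implicit Arguments.
Unset Strict Implicit.
Unset Printing Implicit Defensive.

Import Order.TTheory GRing.Theory Num.Theory.
Local Open Scope classical_set_scope.
Local Open Scope ring_scope.

Definition adjmx (R : rcfType) (n : nat) (G : 'M[R[i]]_n) : 'M[R[i]]_n :=
  (map_mx Num.conj G)^T.

(* The singular values of G : 'M[C]_n, listed with multiplicity:
   sigma_j(G) = sqrt(lambda_j(G^* G)), where lambda_1..lambda_n are the
   eigenvalues (with multiplicity) of the Hermitian psd matrix G^* G, given by
   the diagonal of its spectral (unitary) diagonalization [spectral_diag]. *)
Definition singular_values (R : rcfType) (n : nat) (G : 'M[R[i]]_n) : 'rV[R]_n :=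
  \row_j Num.sqrt (complex.Re (spectral_diag (adjmx G *m G) 0 j)).

Definition sum_singular_values (R : rcfType) (n : nat) (G : 'M[R[i]]_n) : R :=
  \sum_j singular_values G 0 j.

(* A real matrix is viewed as a complex matrix (same singular values). *)
Definition complexify (R : rcfType) (n : nat) (G : 'M[R]_n) : 'M[R[i]]_n :=
  map_mx (fun x => Complex x 0) G.

Definition mutually_independent d (T : measurableType d) (R : realType)
  (P : probability T R) (I : finType) (X : I -> T -> R) : Prop :=
  forall B : I -> set R, (forall i, measurable (B i)) ->
    P (\bigcap_i (X i @^-1` B i)) = (\prod_i P (X i @^-1` B i))%E.

(* X has law N(m, s^2) (s = standard deviation). *)
Definition has_normal_law d (T : measurableType d) (R : realType)
  (P : probability T R) (X : T -> R) (m s : R) : Prop :=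
  forall B : set R, measurable B -> P (X @^-1` B) = normal_prob m s B.

(* Main.v *)
(* Write Z for the d x d Gaussian matrix, lambda_j for the eigenvalues of Z^* Z, and
   fix t > 0.  The dilation K = [[t, Z], [-Z^*, t]] is t plus a skew-Hermitian matrix
   that depends linearly on the Gaussian coordinates x_k; let S_k be its derivative in
   x_k and Q = K^-1, so that |Q_ab| <= 1/t and both diagonal blocks of Q have trace
   sum_j t / (t^2 + lambda_j).  Gaussian integration by parts applied to
   Re tr (S_k Q), whose x_k-derivative is - Re tr (S_k Q S_k Q), gives for
   eta = (1/d) sum_j t^2 / (t^2 + lambda_j) the identity
   E eta + E eta^2 / t^2 = 1 in the complex case, and the left-hand side is at most
   1 + 1/(d t^2) in the real case.  By Jensen h = E eta satisfies
   h^2 + t^2 h <= t^2 + eps with eps = 0, resp. 1/d.  The equality case eps = 0 is the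
   quarter-circle law, and h exceeds its root by at most eps / t^2.
   Finally sqrt lambda = (2/pi) int_0^oo (1 - t^2 / (t^2 + lambda)) dt; replacing this
   integral and the one of the quarter-circle profile, whose value is 4/3, by right
   Riemann sums of step 1/d, resp. 1/sqrt d, costs no more than the error terms. *)
Require Import Defs.
From HB Require Import structures.
From mathcomp Require Import all_boot all_order all_algebra.
From mathcomp Require Import spectral.
From mathcomp Require Import complex.
From mathcomp Require Import all_classical all_reals all_analysis.
From mathcomp Require Import measurable_realfun.
From mathcomp Require Import ring lra.
Import Order.TTheory GRing.Theory Num.Theory.
Import numFieldNormedType.Exports.
Import Normc.
Local Open Scope classical_set_scope.
Local Open Scope ring_scope.
Set Implicit Arguments.
Unset Strict Implicit.
Unset Printing Implicit Defensive.

(** * Gaussian vectors and integration by parts *)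

(* [I -> R] carries no product sigma-algebra in the library: we generate it by boxes. *)
Definition boxes (I : finType) (R : realType) : set (set (I -> R)) :=
  [set A | exists2 B : I -> set R,
     (forall i, measurable (B i)) & A = [set x | forall i, B i (x i)]].

Notation vect I R := (g_sigma_algebraType (@boxes I R)).

Section Vect.
Context {I : finType} {R : realType}.

Lemma measurable_coord (i : I) :
  measurable_fun setT (fun x : vect I R => x i).
Proof.
move=> _ B mB; rewrite setTI; apply: sub_sigma_algebra.
exists (fun j => if j == i then B else setT).
  by move=> j; case: ifP.
apply/seteqP; split => x /=.
  by move=> Bx j; case: eqP => // ->.
by move=> /(_ i); rewrite eqxx.
Qed.

Lemma measurable_vect d (T : measurableType d) (X : T -> vect I R) :
  (forall i, measurable_fun setT (fun w => X w i)) -> measurable_fun setT X.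
Proof.
move=> mX; apply: (measurability (rT := vect I R) (@boxes I R)) => //.
move=> _ [_ [B mB ->] <-].
rewrite setTI (_ : _ @^-1` _ = \bigcap_(i in setT) ((fun w => X w i) @^-1` B i)).
  apply: fin_bigcap_measurable => // i _.
  by rewrite -[X in measurable X]setTI; exact: mX.
by apply/seteqP; split => w /=; move=> H i; [move=> _|]; exact: H.
Qed.

Lemma boxes_setI : setI_closed (@boxes I R).
Proof.
move=> _ _ [A mA ->] [B mB ->]; exists (fun i => A i `&` B i).
  by move=> i; apply: measurableI.
apply/seteqP; split => x /=; first by move=> [? ?] i; split.
by move=> H; split => i; case: (H i).
Qed.

(** Dynkin's argument: boxes are stable under intersection and generate the sigma-algebra, and the
    whole space is a box of finite mass. *)
Lemma vect_measure_unique (m1 m2 : {measure set (vect I R) -> \bar R}) :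
  (m1 setT < +oo)%E ->
  (forall B : I -> set R, (forall i, measurable (B i)) ->
     m1 [set x | forall i, B i (x i)] = m2 [set x | forall i, B i (x i)]) ->
  forall A, measurable A -> m1 A = m2 A.
Proof.
move=> m1oo m12 A mA; apply: (measure_unique (T := vect I R) (@boxes I R) (fun=> setT)) => //.
- exact: boxes_setI.
- by move=> _; exists (fun=> setT) => //; apply/seteqP; split.
- by apply/seteqP; split => // x _; exists 0%N.
- by move=> _ [B mB ->]; exact: m12.
Qed.

End Vect.

Definition upd (I : finType) (R : realType) (x : I -> R) (k : I) (z : R) : vect I R :=
  fun i => if i == k then z else x i.

(** * Replacing one independent coordinate by a fresh draw *)

Section Resampling.
Context d (T : measurableType d) (R : realType) (P : probability T R).
Context (I : finType) (X : I -> {RV P >-> R}) (N : probability (measurableTypeR R) R) (k : I).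
Hypothesis indX : mutually_independent P (fun i => (X i : T -> R)).
Hypothesis lawX : forall B, measurable B -> P (X k @^-1` B) = N B.

Let XX (w : T) : vect I R := fun i => X i w.
Let YY (p : measurableTypeR R * T) : vect I R := upd (fun i => X i p.2) k p.1.

Let mXX : measurable_fun setT XX.
Proof. by apply: measurable_vect => i; exact: measurable_funP. Qed.

Let mYY : measurable_fun setT YY.
Proof.
apply: measurable_vect => i; rewrite /YY /upd; case: eqP => _.
  exact: measurable_fst.
by apply: measurableT_comp => //; exact: measurable_snd.
Qed.

HB.instance Definition _ := isMeasurableFun.Build _ _ _ _ XX mXX.
HB.instance Definition _ := isMeasurableFun.Build _ _ _ _ YY mYY.

(** On a box, both laws factor into the same product of marginals: by independence for [XX], and by
    the product measure together with independence for [YY]. *)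
Let law_eq (A : set (vect I R)) : measurable A ->
  pushforward P XX A = pushforward (N \x P)%E YY A.
Proof.
apply: (@vect_measure_unique _ _ (pushforward P XX) (pushforward (N \x P)%E YY)) => [|B mB].
  by rewrite /= /pushforward preimage_setT probability_setT ltry.
rewrite /= /pushforward.
have -> : XX @^-1` [set x | forall i, B i (x i)] = \bigcap_i (X i @^-1` B i).
  by apply/seteqP; split => w /= H i; [move=> _|]; exact: H.
rewrite indX//.
(* [YY] overwrites coordinate [k], so the old [X k] is left unconstrained; the preimage of a box is
   then a measurable rectangle. *)
pose B' i := if i == k then setT else B i.
have EY : YY @^-1` [set x | forall i, B i (x i)] = B k `*` \bigcap_i (X i @^-1` B' i).
  apply/seteqP; split => -[z w] /=; rewrite /YY /upd /B' /=.
    move=> H; split; first by have := H k; rewrite eqxx.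
    by move=> i _ /=; have := H i; case: eqP.
  move=> [zB H] i; case: eqP => [->//|/eqP ik].
  by have := H i Logic.I; rewrite /= (negbTE ik).
have mB' i : measurable (B' i) by rewrite /B'; case: ifP.
transitivity ((N \x P)%E (B k `*` \bigcap_i (X i @^-1` B' i))); last first.
  exact: (congr1 _ (esym EY)).
transitivity (N (B k) * P (\bigcap_i (X i @^-1` B' i)))%E; last first.
  apply/esym; apply: product_measure1E; first exact: mB.
  apply: fin_bigcap_measurable => // i _.
  by rewrite -[X in measurable X]setTI; exact: measurable_funP.
transitivity (N (B k) * \prod_i P (X i @^-1` B' i))%E; last first.
  exact: (congr1 (fun x => N (B k) * x)%E (esym (indX mB'))).
rewrite (bigD1 k)//= [X in _ = (_ * X)%E](bigD1 k)//= /B' eqxx.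
rewrite preimage_setT probability_setT mul1e; congr (_ * _)%E; first exact: lawX.
by apply: eq_bigr => i /negbTE ->.
Qed.

(** Makes coordinate [k] a separate integration variable, to which Fubini applies. Integrability is
    asked on the product side only, since equality of the image laws carries it over to [P]. *)
Lemma integral_resample (f : vect I R -> R) :
  measurable_fun setT f ->
  (N \x P)%E.-integrable setT (EFin \o (f \o YY)) ->
  (\int[P]_w (f (XX w))%:E = \int[(N \x P)]_p (f (YY p))%:E)%E.
Proof.
move=> mf intf.
have mEf : measurable_fun setT (EFin \o f) by exact/measurable_EFinP.
have intf' : (pushforward (N \x P)%E YY).-integrable setT (EFin \o f).
  exact: integrable_pushforward.
have E : (\int[pushforward P XX]_x `|(f x)%:E| =
          \int[pushforward (N \x P)%E YY]_x `|(f x)%:E|)%E.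
  by apply: eq_measure_integral => A mA _; exact: law_eq.
have intf2 : P.-integrable setT (EFin \o f \o XX).
  move: intf' => /integrableP[_ h]; apply/integrableP; split.
    exact: measurableT_comp.
  move: h; rewrite -E ge0_integral_pushforward//.
  exact: measurableT_comp.
transitivity (\int[pushforward P XX]_x (f x)%:E)%E.
  by rewrite integral_pushforward.
rewrite (eq_measure_integral (pushforward (N \x P)%E YY)); last first.
  by move=> A mA _; exact: law_eq.
by rewrite integral_pushforward.
Qed.

End Resampling.

Section NormalIntegral.
Context {R : realType} (s : R).
Hypothesis s0 : s != 0.
Local Notation mu := (@lebesgue_measure R).
Local Notation N := (normal_prob 0 s).
Local Notation pdf := (normal_pdf 0 s).

Let measurable_pdf : measurable_fun setT (EFin \o pdf).
Proof. by apply/measurable_EFinP; exact: measurable_normal_pdf. Qed.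

(** The Radon-Nikodym derivative of [N] and the density have the same integral over every measurable
    set, hence agree almost everywhere. *)
Lemma ge0_integral_normal_prob (f : R -> R) :
  measurable_fun setT f -> (forall x, 0 <= f x) ->
  (\int[N]_x (f x)%:E = \int[mu]_x (f x * pdf x)%:E)%E.
Proof.
move=> mf f0; pose RN := Radon_Nikodym_SigmaFinite.f N mu.
have dom : N `<< mu := normal_prob_dominates 0 s.
rewrite -(Radon_Nikodym_SigmaFinite.change_of_variables dom) ; first last.
- exact/measurable_EFinP.
- by [].
- by move=> x; rewrite lee_fin.
have mRN : measurable_fun setT RN.
  exact: measurable_int (Radon_Nikodym_SigmaFinite.f_integrable _).
under [RHS]eq_integral do rewrite EFinM.
apply: ae_eq_integral => //.
- by apply: emeasurable_funM => //; exact/measurable_EFinP.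
- by apply: emeasurable_funM => //; exact/measurable_EFinP.
apply: ae_eqe_mul2l; apply: integral_ae_eq => //.
- exact: Radon_Nikodym_SigmaFinite.f_integrable.
- move=> E _ mE; rewrite -Radon_Nikodym_SigmaFinite.f_integral//.
Qed.

Lemma normal_pdf0E x : pdf x = normal_peak s * expR (- x ^+ 2 / (s ^+ 2 *+ 2)).
Proof. by rewrite normal_pdfE// /normal_fun subr0. Qed.

End NormalIntegral.

(** * Stein's identity for a one-dimensional Gaussian *)

Section Stein.
Context {R : realType} (s : R).
Hypothesis s0 : 0 < s.
Local Notation mu := (@lebesgue_measure R).
Local Notation N := (normal_prob 0 s).
Local Notation pdf := (normal_pdf 0 s).

Let sn0 : s != 0. Proof. by rewrite gt_eqF. Qed.

(* With u = x^2 / (4 s^2) this is |x| exp (-2 u) <= C exp (-u). *)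
Lemma normal_pdf_mul_abs_le : exists2 C : R, 0 <= C &
  forall x, `|x| * pdf x <= C * normal_pdf 0 (s * Num.sqrt 2) x.
Proof.
have q0 : (0:R) < Num.sqrt 2 by rewrite sqrtr_gt0.
have s20 : s * Num.sqrt 2 != 0 by rewrite mulf_neq0// gt_eqF.
exists ((1 + 4 * s ^+ 2) * normal_peak s / normal_peak (s * Num.sqrt 2)).
  by rewrite !mulr_ge0 ?invr_ge0 ?normal_peak_ge0// addr_ge0// mulr_ge0// sqr_ge0.
move=> x; rewrite !normal_pdf0E//.
rewrite [leRHS]mulrA divfK ?gt_eqF ?normal_peak_gt0//.
rewrite [leLHS]mulrCA [leRHS]mulrAC [leRHS]mulrC ler_wpM2l ?normal_peak_ge0//.
have -> : (s * Num.sqrt 2) ^+ 2 *+ 2 = 4 * s ^+ 2.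
  by rewrite exprMn sqr_sqrtr//; ring.
set u := x ^+ 2 / (4 * s ^+ 2).
have s2 : 0 < 4 * s ^+ 2 by rewrite mulr_gt0// exprn_gt0.
have -> : - x ^+ 2 / (4 * s ^+ 2) = - u by rewrite mulNr.
have -> : - x ^+ 2 / (s ^+ 2 *+ 2) = - u + - u.
  by rewrite /u -(mulr_natr (s ^+ 2) 2); field; exact: sn0.
rewrite expRD mulrA ler_wpM2r ?expR_ge0//.
have u0 : 0 <= u by rewrite divr_ge0 ?sqr_ge0// ltW.
rewrite expRN ler_pdivrMr ?expR_gt0//.
have ux : 4 * s ^+ 2 * u = `|x| ^+ 2 by rewrite mulrC divfK ?gt_eqF// real_normK// num_real.
have := expR_ge1Dx u; have := normr_ge0 x.
set e := expR u; set y := `|x| in ux *; set c := 4 * s ^+ 2 in ux s2 *.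
move=> y0 eu; apply: (@le_trans _ _ ((1 + c) * (1 + u))); last first.
  by rewrite ler_wpM2l// addr_ge0// ltW.
(* Here [2 y <= 1 + y^2 = 1 + c u], which is below [(1 + c) (1 + u)] up to nonnegative terms; this
   is where the constant [1 + 4 s^2] comes from. *)
have := sqr_ge0 (y - 1); rewrite -subr_ge0 in eu *; nra.
Qed.

Let measurable_abs : measurable_fun setT (fun x : R => `|x|).
Proof. exact: measurableT_comp. Qed.

(** The integrand is dominated by a multiple of the density of the wider Gaussian of deviation
    [s * sqrt 2], which has total mass 1. *)
Lemma integrable_normal_abs : N.-integrable setT (EFin \o (fun x : R => `|x|)).
Proof.
apply/integrableP; split; first exact/measurable_EFinP.
under eq_integral do rewrite /= normr_id.
rewrite ge0_integral_normal_prob//.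
have [C C0 CP] := normal_pdf_mul_abs_le.
apply: (@le_lt_trans _ _ (\int[mu]_x (C%:E * (normal_pdf 0 (s * Num.sqrt 2) x)%:E))%E).
  apply: ge0_le_integral => //.
  - by move=> x _; rewrite lee_fin mulr_ge0// normal_pdf_ge0.
  - apply/measurable_EFinP; apply: measurable_funM => //.
    exact: measurable_normal_pdf.
  - apply: emeasurable_funM => //; apply/measurable_EFinP.
    exact: measurable_normal_pdf.
  - by move=> x _; rewrite lee_fin.
rewrite integralZl//; last exact: integrable_normal_pdf.
by rewrite integral_normal_pdf mule1 ltry.
Qed.

Variables (f g : R -> R) (C : R).
Hypothesis df : forall z, is_derive (z : R) (1 : R) f (g z).
Hypothesis cg : continuous g.
Hypothesis fC : forall z, `|f z| <= C.
Hypothesis gC : forall z, `|g z| <= C.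

Let cf : continuous f.
Proof.
by move=> z; apply/differentiable_continuous/derivable1_diffP; case: (df z).
Qed.

Let mf : measurable_fun setT f. Proof. exact: continuous_measurable_fun. Qed.
Let mg : measurable_fun setT g. Proof. exact: continuous_measurable_fun. Qed.

Let h (z : R) := z * f z - s ^+ 2 * g z.
Let b (z : R) := C * `|z| + s ^+ 2 * C.
Let H z := h z * pdf z.
Let F z := - s ^+ 2 * (f z * pdf z).

Let mh : measurable_fun setT h.
Proof. by apply: measurable_funB; apply: measurable_funM. Qed.

Let mb : measurable_fun setT b.
Proof. by apply: measurable_funD => //; apply: measurable_funM. Qed.

Let hb z : `|h z| <= b z.
Proof.
rewrite (le_trans (ler_normB _ _))// normrM normrM (ger0_norm (sqr_ge0 s)).
by rewrite lerD// ?ler_wpM2l ?sqr_ge0// mulrC ler_wpM2r.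
Qed.

Let C0 : 0 <= C. Proof. exact: le_trans (fC 0). Qed.

Let intNb : N.-integrable setT (EFin \o b).
Proof.
rewrite (_ : EFin \o b = (fun x => C%:E * (EFin \o (fun y : R => `|y|%R)) x + (s ^+ 2 * C)%:E)%E) //.
apply: integrableD => //; first exact: integrableZl integrable_normal_abs.
exact: finite_measure_integrable_cst.
Qed.

Let b0 z : 0 <= b z.
Proof. by rewrite addr_ge0// mulr_ge0// sqr_ge0. Qed.

Let intbpdf : mu.-integrable setT (fun z => (b z * pdf z)%:E).
Proof.
apply/integrableP; split.
  apply/measurable_EFinP; apply: measurable_funM => //.
  exact: measurable_normal_pdf.
under eq_integral do rewrite /= ger0_norm ?mulr_ge0 ?normal_pdf_ge0//.
rewrite -ge0_integral_normal_prob//.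
move/integrableP: intNb => [_]; apply: le_lt_trans.
by under [leRHS]eq_integral do rewrite /= ger0_norm//.
Qed.

(** The density satisfies [pdf' = - z / s^2 * pdf], so [F = - s^2 f pdf] is an antiderivative of the
    Stein integrand [H]. *)
Let dF z : is_derive (z : R) (1 : R) F (H z).
Proof.
pose c : R := - (s ^+ 2 *+ 2)^-1.
have -> : F = (fun z => - s ^+ 2 * (f z * (normal_peak s * expR (c * z ^+ 2)))).
  apply/funext => x; rewrite /F normal_pdf0E//; congr (_ * (_ * (_ * expR _))).
  by rewrite /c; ring.
apply: is_derive_eq.
rewrite /H /h normal_pdf0E// /GRing.scale /=.
have -> : - z ^+ 2 / (s ^+ 2 *+ 2) = c * z ^+ 2 by rewrite /c; ring.
by rewrite /c -(mulr_natr (s ^+ 2) 2); field; exact: sn0.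
Qed.

(** The boundary terms need only vanish in the limit, so [1 + x <= expR x] is enough: it gives [exp
    (- x^2 / (2 s^2)) <= 2 s^2 / x^2 <= 2 s^2 / x] for [x >= 1]. *)
Let F_le n : `|F n.+1%:R| + `|F (- n.+1%:R)| <= 4 * s ^+ 4 * C * normal_peak s * n.+1%:R^-1.
Proof.
have L x : `|F x| <= s ^+ 2 * (C * (normal_peak s * expR (- x ^+ 2 / (s ^+ 2 *+ 2)))).
  rewrite /F mulNr normrN normrM (ger0_norm (sqr_ge0 _)) ler_wpM2l ?sqr_ge0//.
  rewrite normrM -normal_pdf0E// (ger0_norm (normal_pdf_ge0 _ _ _)).
  by rewrite ler_wpM2r// normal_pdf_ge0.
apply: (le_trans (lerD (L _) (L _))); rewrite sqrrN.
set e := expR _.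
have e_le : e <= 2 * s ^+ 2 * n.+1%:R^-1.
  have c0 : 0 < 2 * s ^+ 2 by rewrite mulr_gt0// exprn_gt0.
  rewrite /e mulNr expRN.
  rewrite -[leRHS]invrK lef_pV2 ?posrE ?expR_gt0 ?invr_gt0 ?divr_gt0//.
  apply: (le_trans _ (expR_ge1Dx _)).
  rewrite -(mulr_natr (s ^+ 2) 2) (mulrC (s ^+ 2)) invf_div.
  rewrite -[leLHS]add0r lerD// ler_wpM2r ?invr_ge0//; first exact: ltW.
  by rewrite expr2 ler_peMl// ler1n.
have -> : 4 * s ^+ 4 * C * normal_peak s * n.+1%:R^-1 =
   2 * s ^+ 2 * C * normal_peak s * (2 * s ^+ 2 * n.+1%:R^-1) by ring.
have -> : s ^+ 2 * (C * (normal_peak s * e)) + s ^+ 2 * (C * (normal_peak s * e))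
   = 2 * s ^+ 2 * C * normal_peak s * e by ring.
rewrite ler_wpM2l// mulr_ge0 ?normal_peak_ge0// mulr_ge0// mulr_ge0//.
exact: sqr_ge0.
Qed.

Let cH : continuous H.
Proof.
move=> z; apply: cvgM; last exact: continuous_normal_pdf.
apply: cvgB; apply: cvgM; [exact: cvg_id|exact: cf|exact: cvg_cst|exact: cg].
Qed.

Let mH : measurable_fun setT H. Proof. exact: continuous_measurable_fun. Qed.

Let Hb z : `|H z| <= b z * pdf z.
Proof.
by rewrite /H normrM (ger0_norm (normal_pdf_ge0 _ _ _)) ler_wpM2r// normal_pdf_ge0.
Qed.

Let intH : mu.-integrable setT (EFin \o H).
Proof.
apply: (le_integrable measurableT _ _ intbpdf); first exact/measurable_EFinP.
move=> z _ /=; rewrite lee_fin (le_trans (Hb z))// ler_norm//.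
Qed.

Let D n : set R := `[- n.+1%:R, n.+1%:R].

Let integral_D n : (\int[mu]_(z in D n) (H z)%:E = (F n.+1%:R - F (- n.+1%:R))%:E)%E.
Proof.
have cF : continuous F.
  by move=> z; apply/differentiable_continuous/derivable1_diffP; case: (dF z).
rewrite (@continuous_FTC2 _ H F) ?EFinB//.
- by rewrite (@lt_trans _ _ 0)// ?oppr_lt0.
- exact: continuous_subspaceT.
- split => [z _| |]; first by case: (dF z).
  + by apply: cvg_at_right_filter; exact: cF.
  + by apply: cvg_at_left_filter; exact: cF.
- by move=> z _; rewrite derive1E; have [_ ->] := dF z.
Qed.

(** Fundamental theorem of calculus on growing symmetric intervals: the boundary terms tend to 0,
    and dominated convergence with majorant [b * pdf] passes to the whole line. *)
Let integral_H : (\int[mu]_z (H z)%:E = 0)%E.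
Proof.
pose HD n z := ((EFin \o H) \_ (D n)) z.
have mHD n : measurable_fun setT (HD n).
  apply/(measurable_restrictT _ _).1 => //; first exact: measurable_itv.
  by apply/measurable_funTS/measurable_EFinP.
have HDH z : HD ^~ z @ \oo --> (H z)%:E.
  apply: cvg_near_cst; near=> n.
  rewrite /HD patchE ifT// inE /D /= in_itv /= -ler_norml.
  apply: (@le_trans _ _ n%:R); last by rewrite ler_nat.
  by near: n; exact: nbhs_infty_ger.
have HDb n z : (`|HD n z| <= (b z * pdf z)%:E)%E.
  rewrite /HD patchE; case: ifP => _; first by rewrite lee_fin.
  by rewrite abse0 lee_fin (le_trans _ (Hb z)).
have dc := @dominated_convergence _ (measurableTypeR R) R mu setT measurableT HD
  (EFin \o H) (fun z => (b z * pdf z)%:E) mHD.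
have {dc} [||//||_ _ cv1] := dc.
- exact: measurable_int intH.
- by apply: aeW => z _; exact: HDH.
- by apply: aeW => z n _; exact: HDb.
apply: (cvg_unique _ cv1) => //=.
rewrite (_ : (fun n => _) = EFin \o (fun n => F n.+1%:R - F (- n.+1%:R))); last first.
  by apply/funext => n /=; rewrite -integral_D [RHS]integral_mkcond.
apply: cvg_EFin; first by near=> n.
apply/norm_cvg0P.
pose K := 4 * s ^+ 4 * C * normal_peak s.
apply: (@squeeze_cvgr _ _ _ _ (fun=> 0) (fun n => K * harmonic n)).
- by near=> n; rewrite normr_ge0 /= (le_trans (ler_normB _ _))// F_le.
- exact: cvg_cst.
- by rewrite -(mulr0 K); apply: cvgMr; exact: cvg_harmonic.
Unshelve. all: by end_near. Qed.

Lemma integral_normal_stein : (\int[N]_z (z * f z - s ^+ 2 * g z)%:E = 0)%E.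
Proof.
have hb0 z : 0 <= h z + b z.
  by have := hb z; rewrite ler_norml => /andP[]; rewrite lerNl -subr_ge0 opprK addrC.
have intNh : N.-integrable setT (EFin \o h).
  apply: (le_integrable measurableT _ _ intNb); first exact/measurable_EFinP.
  by move=> z _ /=; rewrite lee_fin (le_trans (hb z))// ler_norm.
(* The passage from [N] to the density is available for nonnegative integrands, while [h] is signed;
   adding [b >= |h|] repairs this, and its finite integral is cancelled afterwards. *)
have : (\int[N]_z (h z + b z)%:E = \int[N]_z (b z)%:E)%E.
  rewrite !ge0_integral_normal_prob//; last exact: measurable_funD.
  under eq_integral do rewrite mulrDl EFinD.
  by rewrite integralD// integral_H add0e.
under eq_integral do rewrite EFinD.
rewrite integralD//=.
have bfin : (\int[N]_z (b z)%:E)%E \is a fin_num by exact: integrable_fin_num intNb.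
by move=> /(congr1 (fun x => x - \int[N]_z (b z)%:E)%E); rewrite addeK// subee.
Qed.

End Stein.

(** * Stein's identity along one coordinate of a Gaussian vector *)

Section SteinVector.
Context d (T : measurableType d) (R : realType) (P : probability T R).
Context (I : finType) (X : I -> {RV P >-> R}) (s : R) (k : I).
Hypothesis s0 : 0 < s.
Hypothesis indX : mutually_independent P (fun i => (X i : T -> R)).
Hypothesis lawX : has_normal_law P (X k) 0 s.

Lemma integrable_normal_law : P.-integrable setT (EFin \o X k).
Proof.
have mX : measurable_fun setT (X k) by exact: measurable_funP.
apply/integrableP; split; first exact/measurable_EFinP.
have ma : measurable_fun setT (fun z : R => `|z|%R%:E).
  by apply/measurable_EFinP; exact: normr_measurable.
have := @ge0_integral_pushforward _ _ T (measurableTypeR R) R _ mX P setT (fun z => `|z|%R%:E) measurableT ma.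
rewrite preimage_setT => /= <-; last by move=> z _; rewrite lee_fin.
apply: (@le_lt_trans _ _ (\int[normal_prob 0 s]_z `|z|%R%:E)%E).
  rewrite le_eqVlt; apply/orP; left; apply/eqP.
  by apply: eq_measure_integral => A mA _; exact: lawX.
have /integrableP[_] := integrable_normal_abs s0.
by under eq_integral do rewrite /= normr_id.
Qed.

Variables (f g : vect I R -> R) (C : R).
Hypothesis mf : measurable_fun setT f.
Hypothesis mg : measurable_fun setT g.
Hypothesis fC : forall x, `|f x| <= C.
Hypothesis gC : forall x, `|g x| <= C.
Hypothesis df : forall (x : I -> R) (z : R),
  is_derive z (1 : R) (fun t : R => f (upd x k t)) (g (upd x k z)).
Hypothesis cg : forall x : I -> R, continuous (fun t : R => g (upd x k t)).

Let XX (w : T) : vect I R := fun i => X i w.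

Let mXX : measurable_fun setT XX.
Proof. by apply: measurable_vect => i; exact: measurable_funP. Qed.

Let C0 : 0 <= C. Proof. exact: le_trans (fC (fun=> 0)). Qed.

Let N : probability (measurableTypeR R) R := normal_prob 0 s.
Let h (x : vect I R) := x k * f x - s ^+ 2 * g x.

Let mh : measurable_fun setT h.
Proof.
apply: measurable_funB; apply: measurable_funM => //.
exact: measurable_coord.
Qed.

(** By Tonelli: for fixed [z] the integrand is at most [C |z| + s^2 C] uniformly in [w], and this
    bound is integrable under [N]. *)
Let intNP : (N \x P)%E.-integrable setT
  (EFin \o (h \o (fun p : measurableTypeR R * T => upd (fun i => X i p.2) k p.1))).
Proof.
set hY := EFin \o _.
have mhY : measurable_fun setT hY.
  by apply/measurable_EFinP; exact: measurableT_comp.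
apply/(integrable12ltyP _ _ mhY).
apply: (@le_lt_trans _ _ (\int[N]_z (C * `|z| + s ^+ 2 * C)%:E)%E); last first.
  have : N.-integrable setT (fun z : R => C%:E * (EFin \o (fun y : R => `|y|%R)) z + (s ^+ 2 * C)%:E)%E.
    apply: integrableD => //; first exact: integrableZl (integrable_normal_abs s0).
    exact: finite_measure_integrable_cst.
  move=> /integrableP[_]; apply: le_lt_trans; rewrite le_eqVlt; apply/orP; left; apply/eqP.
  apply: eq_integral => z _ /=.
  have b0 : 0 <= C * `|z| + s ^+ 2 * C by rewrite addr_ge0// mulr_ge0// sqr_ge0.
  by rewrite (ger0_norm b0).
have bnd z w : (`|hY (z, w)| <= (C * `|z| + s ^+ 2 * C)%:E)%E.
  rewrite lee_fin /h /= /upd eqxx (le_trans (ler_normB _ _))// normrM normrM.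
  rewrite (ger0_norm (sqr_ge0 s)) lerD// ?ler_wpM2l ?sqr_ge0//.
  by rewrite mulrC ler_wpM2r.
apply: ge0_le_integral => //.
- by move=> z _; apply: integral_ge0 => w _.
- have mab : measurable_fun setT (abse \o hY) by exact: measurableT_comp.
  have ab0 x : (0 <= (abse \o hY) x)%E by exact: abse_ge0.
  exact: (measurable_fun_fubini_tonelli_F (m2 := P) (abse \o hY) mab ab0).
- apply/measurable_EFinP; apply: measurable_funD => //.
  by apply: measurable_funM => //; exact: normr_measurable.
- move=> z _; apply: (@le_trans _ _ (\int[P]_w (C * `|z| + s ^+ 2 * C)%:E)%E); last first.
    by rewrite integral_cst// [X in (_ * X)%E](_ : _ = 1%E) ?mule1//; exact: probability_setT.
  apply: ge0_le_integral => //.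
  by apply: measurableT_comp => //; exact: measurableT_comp.
Qed.

Let mfX : measurable_fun setT (f \o XX). Proof. exact: measurableT_comp. Qed.
Let mgX : measurable_fun setT (g \o XX). Proof. exact: measurableT_comp. Qed.

Lemma integrable_stein_l : P.-integrable setT (fun w => (X k w * f (XX w))%:E).
Proof.
apply: (@le_integrable _ _ _ _ _ measurableT _ (fun w => C%:E * (EFin \o X k) w)%E).
- by apply/measurable_EFinP; apply: measurable_funM.
- move=> w _; rewrite /= lee_fin !normrM mulrC ler_wpM2r//.
  by rewrite (ger0_norm C0).
- exact: integrableZl integrable_normal_law.
Qed.

Lemma integrable_stein_r : P.-integrable setT (fun w => (s ^+ 2 * g (XX w))%:E).
Proof.
apply: (@le_integrable _ _ _ _ _ measurableT _ (fun w => (s ^+ 2 * C)%:E)%E).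
- by apply/measurable_EFinP; apply: measurable_funM.
- move=> w _; rewrite /= lee_fin !normrM ler_wpM2l//.
  by rewrite (ger0_norm C0).
- exact: finite_measure_integrable_cst.
Qed.

Lemma integral_stein :
  (\int[P]_w (X k w * f (XX w))%:E = \int[P]_w (s ^+ 2 * g (XX w))%:E)%E.
Proof.
have h0 : (\int[P]_w (h (XX w))%:E = 0)%E.
  rewrite (integral_resample indX lawX mh intNP).
  (* Fubini with [z] innermost: for fixed [w] the inner integral is the one-dimensional Stein
     identity along coordinate [k], so it vanishes. *)
  rewrite -(integral21_prod_meas1 intNP).
  rewrite (eq_integral (fun=> 0%E)) ?integral0// => w _.
  rewrite -[RHS](integral_normal_stein s0 (df (fun i => X i w)) (@cg _)
     (fun z => fC (upd (fun i => X i w) k z)) (fun z => gC (upd (fun i => X i w) k z))).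
  by apply: eq_integral => z _; rewrite /h /= /upd eqxx.
have intf := integrable_stein_l.
have intg := integrable_stein_r.
move: h0; rewrite /h; under eq_integral do rewrite EFinB.
rewrite integralB// => /eqP; rewrite sube_eq ?add0e.
- by move=> /eqP.
- exact: integrable_fin_num intf.
- rewrite fin_num_adde_defr//; exact: integrable_fin_num intg.
Qed.

End SteinVector.

(** * The skew-Hermitian dilation and its resolvent *)

Lemma mulmx_conj_inv (F : fieldType) (m : nat) (P D D' : 'M[F]_m) :
  P \in unitmx -> D *m D' = 1%:M ->
  (invmx P *m D *m P) *m (invmx P *m D' *m P) = 1%:M.
Proof.
by move=> uP DD; rewrite !mulmxA mulmxK// -(mulmxA (invmx P)) DD mulmx1 mulVmx.
Qed.

Section Dilation.
Context {R : realType} {n : nat}.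
Local Notation C := R[i].
Local Open Scope complex_scope.
Implicit Types (Z : 'M[C]_n).

Lemma conjE (z : C) : Num.conj z = conjc z.
Proof. by []. Qed.

Lemma adjmxM m (A B : 'M[C]_m) : adjmx (A *m B) = adjmx B *m adjmx A.
Proof. by rewrite /adjmx map_mxM trmx_mul. Qed.

Lemma adjmxK m (A : 'M[C]_m) : adjmx (adjmx A) = A.
Proof. by apply/matrixP => i j; rewrite !mxE conjCK. Qed.

Lemma adjmxE m (A : 'M[C]_m) : adjmx A = map_mx Num.conj A^T.
Proof. by rewrite /adjmx map_trmx. Qed.

Section Gram.
Variable Z : 'M[C]_n.
Let A := adjmx Z *m Z.
Let P := spectralmx A.
Let sp := spectral_diag A.

Let Punitary : P \is unitarymx. Proof. exact: spectral_unitarymx. Qed.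
Let Punit : P \in unitmx. Proof. exact: spectral_unit. Qed.

Let gram_spectral : A = invmx P *m diag_mx sp *m P.
Proof.
apply/orthomx_spectralP/normalmxP.
by rewrite -adjmxE /A adjmxM adjmxK.
Qed.

(** In the eigenbasis, the entry is a diagonal entry of [B B^*] with [B = P Z^*], a sum of squared
    moduli. *)
Lemma gram_spectral_ge0 j : 0 <= sp 0 j.
Proof.
have : diag_mx sp = P *m A *m invmx P.
  by rewrite gram_spectral !mulmxA mulmxV// mul1mx mulmxK.
move=> /matrixP/(_ j j); rewrite mxE eqxx mulr1n => ->.
rewrite (invmx_unitary Punitary) -adjmxE /A mulmxA -mulmxA.
rewrite -[P in P *m adjmx Z]adjmxK -adjmxM mxE sumr_ge0// => k _.
by rewrite !mxE mulrC mul_conjC_ge0.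
Qed.

Definition gram_eig j : R := complex.Re (sp 0 j).

Lemma gram_eig_ge0 j : 0 <= gram_eig j.
Proof.
by have := gram_spectral_ge0 j; rewrite lecE => /andP[_].
Qed.

Let spE j : sp 0 j = (gram_eig j)%:C.
Proof. by rewrite /gram_eig RRe_real// ger0_real// gram_spectral_ge0. Qed.

Lemma gram_resolvent (s : R) : 0 < s ->
  exists Q : 'M[C]_n, [/\ (s%:C%:M + A) *m Q = 1%:M, Q *m (s%:C%:M + A) = 1%:M &
    \tr Q = (\sum_j (s + gram_eig j)^-1)%:C].
Proof.
move=> s0.
pose D : 'rV[C]_n := \row_j (s%:C + sp 0 j)^-1.
pose E : 'rV[C]_n := \row_j (s%:C + sp 0 j).
have EA : s%:C%:M + A = invmx P *m diag_mx E *m P.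
  have -> : diag_mx E = s%:C%:M + diag_mx sp.
    by apply/matrixP => i j; rewrite !mxE; have [->|_] := eqVneq i j; rewrite ?mulr1n// !mulr0n addr0.
  by rewrite mulmxDr mulmxDl -gram_spectral scalar_mxC mulmxKV.
have ne0 j : s%:C + sp 0 j != 0.
  by rewrite spE -rmorphD /= (inj_eq (@complexI R) _ 0) gt_eqF// ltr_wpDr ?gram_eig_ge0.
have ED : diag_mx E *m diag_mx D = 1%:M.
  apply/matrixP => i j; rewrite mul_diag_mx !mxE.
  by have [->|] := eqVneq i j; rewrite ?mulr1n ?divff// !mulr0n mulr0.
have DE : diag_mx D *m diag_mx E = 1%:M by rewrite diag_mxC.
exists (invmx P *m diag_mx D *m P); split.
- by rewrite EA; exact: mulmx_conj_inv.
- by rewrite EA; exact: mulmx_conj_inv.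
- rewrite mxtrace_mulC mulmxA mulmxV// mul1mx mxtrace_diag rmorph_sum/=.
  apply: eq_bigr => j _; rewrite mxE spE -rmorphD.
  by rewrite -fmorphV.
Qed.

End Gram.

(* Linear in [Z] up to the constant [t], unlike [t ^+ 2 + Z^* Z]: the derivatives of its
   inverse are then products of resolvents and constant matrices. *)
Definition dilation (t : R) Z : 'M[C]_(n + n) :=
  block_mx t%:C%:M Z (- adjmx Z) t%:C%:M.

Lemma dilation_inv (t : R) Z : 0 < t -> exists Q : 'M[C]_(n + n),
  [/\ dilation t Z *m Q = 1%:M,
     \tr (ulsubmx Q) = (\sum_j t / (t ^+ 2 + gram_eig Z j))%:C &
     \tr (drsubmx Q) = (\sum_j t / (t ^+ 2 + gram_eig Z j))%:C].
Proof.
move=> t0; have [|R2 [AR RA trR]] := @gram_resolvent Z (t ^+ 2); first exact: exprn_gt0.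
have tn0 : t%:C != 0 by rewrite (inj_eq (@complexI R) _ 0) gt_eqF.
pose u := t%:C.
pose R1 := (u ^+ 2)^-1 *: (1%:M - Z *m R2 *m adjmx Z).
have uu : (t ^+ 2)%:C = u ^+ 2 by rewrite rmorphXn.
have u2 : u ^+ 2 != 0 by rewrite expf_neq0.
rewrite uu in AR RA.
have AR' : adjmx Z *m Z *m R2 = 1%:M - u ^+ 2 *: R2.
  by rewrite -AR mulmxDl mul_scalar_mx addrC addKr.
have R1E : u ^+ 2 *: R1 + Z *m R2 *m adjmx Z = 1%:M.
  by rewrite /R1 scalerA divff// scale1r subrK.
have ZR1 : adjmx Z *m R1 = R2 *m adjmx Z.
  rewrite /R1 -scalemxAr mulmxBr mulmx1 !mulmxA AR' mulmxBl mul1mx opprB addrC subrK.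
  by rewrite -scalemxAl scalerA mulVf// scale1r.
have trE : u * (\sum_j (t ^+ 2 + gram_eig Z j)^-1)%:C =
           (\sum_j t / (t ^+ 2 + gram_eig Z j))%:C.
  by rewrite -rmorphM /= mulr_sumr.
exists (block_mx (u *: R1) (- (Z *m R2)) (R2 *m adjmx Z) (u *: R2)); split.
- rewrite /dilation mulmx_block -/u !mul_scalar_mx [RHS]scalar_mx_block.
  congr block_mx.
  + by rewrite scalerA -expr2 mulmxA.
  + by rewrite scalerN -scalemxAr addNr.
  + by rewrite -scalemxAr mulNmx ZR1 scalerN addNr.
  + by rewrite mulNmx mulmxN opprK mulmxA scalerA -expr2 AR' subrK.
- rewrite block_mxKul mxtraceZ /R1 mxtraceZ raddfB /= mxtrace1.
  rewrite mxtrace_mulC mulmxA AR' raddfB /= mxtrace1 mxtraceZ subKr mulKf//.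
  by rewrite trR.
- by rewrite block_mxKdr mxtraceZ trR.
Qed.

End Dilation.

(** * Differentiating resolvent traces through explicit remainder bounds *)

Section Calculus.
Context {R : realType}.

(** Resolvent identities give the first-order expansion with an exact quadratic remainder; this
    criterion turns it into a derivative with no calculus of matrix-valued functions. *)
Lemma is_derive_quadratic (f : R -> R) (z l L : R) :
  (forall z', `|f z' - f z - (z' - z) * l| <= L * (z' - z) ^+ 2) ->
  is_derive z (1 : R) f l.
Proof.
move=> fL.
have L0 : 0 <= L.
  have := fL (z + 1); have -> : z + 1 - z = 1 by ring.
  by rewrite expr1n mulr1; apply: le_trans.
have H : (fun h => h^-1 *: ((f \o shift z) (h *: 1) - f z)) @ 0^' --> l.
  apply/cvgrPdist_le => e e0; near=> h.
  have h0 : h != 0 by near: h; exact: nbhs_dnbhs_neq.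
  have := fL (h + z); rewrite addrK => fLh.
  rewrite /= /GRing.scale /= mulr1.
  have -> : l - h^-1 * (f (h + z) - f z) = - h^-1 * (f (h + z) - f z - h * l).
    by field.
  rewrite normrM normrN normfV ler_pdivrMl ?normr_gt0//.
  rewrite (le_trans fLh)// -(real_normK (num_real h)) expr2 mulrA mulrC.
  rewrite ler_wpM2l//.
  (* [L] may be 0, so the threshold on [h] is [e / (L + 1)]. *)
  apply: (@le_trans _ _ ((L + 1) * `|h|)); first by rewrite ler_wpM2r// lerDl.
  rewrite mulrC -ler_pdivlMr ?ltr_wpDl//.
  near: h; apply: dnbhs0_le.
  by rewrite divr_gt0// ltr_wpDl.
apply: DeriveDef; first by apply/cvg_ex; exists l.
exact/cvg_lim.
Unshelve. all: by end_near. Qed.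

Lemma lipschitz_continuous (f : R -> R) (L : R) :
  (forall z z', `|f z' - f z| <= L * `|z' - z|) -> continuous f.
Proof.
move=> fL z.
have L0 : 0 <= L.
  have := fL z (z + 1); have -> : z + 1 - z = 1 by ring.
  by rewrite normr1 mulr1; apply: le_trans.
apply/cvgrPdist_le => e e0; near=> y.
rewrite distrC (le_trans (fL _ _))//.
apply: (@le_trans _ _ ((L + 1) * `|y - z|)); first by rewrite ler_wpM2r// lerDl.
rewrite mulrC -ler_pdivlMr ?ltr_wpDl// distrC.
near: y; apply: cvgr_dist_le; first exact: cvg_id.
by rewrite divr_gt0// ltr_wpDl.
Unshelve. all: by end_near. Qed.

End Calculus.

Section MatrixNorm.
Context {R : rcfType}.
Local Notation C := R[i].
Local Open Scope complex_scope.

(** The entrywise l1 norm: it is submultiplicative and dominates [|Re tr|], and any finite bound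
    suffices for differentiability and integrability. *)
Definition norm1mx m n (A : 'M[C]_(m, n)) : R := \sum_i \sum_j normc (A i j).

Lemma normc_ge0 (z : C) : 0 <= normc z.
Proof. by case: z => a b; rewrite /normc sqrtr_ge0. Qed.

Lemma normc_sum (I : Type) (r : seq I) (F : I -> C) :
  normc (\sum_(i <- r) F i) <= \sum_(i <- r) normc (F i).
Proof.
elim/big_ind2: _ => [|x a y b xa yb|//]; first by rewrite normc0.
by rewrite (le_trans (le_normcD _ _))// lerD.
Qed.

Lemma Re_le_normc (z : C) : `|complex.Re z| <= normc z.
Proof.
by case: z => a b /=; rewrite -sqrtr_sqr ler_wsqrtr// lerDl sqr_ge0.
Qed.

Lemma ReD (x y : C) : complex.Re (x + y) = complex.Re x + complex.Re y.
Proof. by case: x; case: y. Qed.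

Lemma ReN (x : C) : complex.Re (- x) = - complex.Re x.
Proof. by case: x. Qed.

Lemma ReB (x y : C) : complex.Re (x - y) = complex.Re x - complex.Re y.
Proof. by rewrite ReD ReN. Qed.

Lemma ReZ (a : R) (z : C) : complex.Re (a%:C * z) = a * complex.Re z.
Proof. by case: z => x y /=; rewrite mul0r subr0. Qed.

Lemma Re_sum (I : Type) (r : seq I) (F : I -> C) :
  complex.Re (\sum_(i <- r) F i) = \sum_(i <- r) complex.Re (F i).
Proof. exact: (big_morph _ ReD). Qed.

Lemma norm1mx_ge0 m n (A : 'M[C]_(m, n)) : 0 <= norm1mx A.
Proof. by do 2![rewrite sumr_ge0// => ? _]; rewrite normc_ge0. Qed.

Lemma norm1mxM m n p (A : 'M[C]_(m, n)) (B : 'M[C]_(n, p)) :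
  norm1mx (A *m B) <= norm1mx A * norm1mx B.
Proof.
rewrite /norm1mx mulr_suml ler_sum// => i _.
apply: (@le_trans _ _ (\sum_j \sum_k normc (A i k) * normc (B k j))).
  rewrite ler_sum// => j _; rewrite mxE (le_trans (normc_sum _ _))//.
  by rewrite ler_sum// => k _; rewrite normcM.
rewrite exchange_big mulr_suml ler_sum//= => k _.
rewrite -mulr_sumr ler_wpM2l ?normc_ge0//.
rewrite [leRHS](bigD1 k)//= lerDl.
by do 2![rewrite sumr_ge0// => ? _]; rewrite normc_ge0.
Qed.

Lemma Re_tr_le_norm1mx m (A : 'M[C]_m) : `|complex.Re (\tr A)| <= norm1mx A.
Proof.
rewrite (le_trans (Re_le_normc _))// (le_trans (normc_sum _ _))//.
rewrite ler_sum// => i _; rewrite (bigD1 i)//= lerDl sumr_ge0// => ? _.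
exact: normc_ge0.
Qed.

End MatrixNorm.

(** The cross terms [tr (S B S A)] and [tr (S A S B)] agree by cyclicity of the trace and cancel. *)
Lemma mxtrace_quad_sub (F : comNzRingType) (m : nat) (S A B : 'M[F]_m) :
  \tr (S *m A *m S *m A) - \tr (S *m B *m S *m B) =
  \tr (S *m (A - B) *m S *m A) + \tr (S *m (A - B) *m S *m B).
Proof.
have X : \tr (S *m B *m S *m A) = \tr (S *m A *m S *m B).
  by rewrite -(mulmxA (S *m B)) mxtrace_mulC !mulmxA.
by rewrite !mulmxBr !mulmxBl !raddfB /= X addrA subrK.
Qed.

Section SkewResolvent.
Context {R : realType} {m : nat}.
Local Notation C := R[i].
Local Open Scope complex_scope.

Section Bound.
Variables (t : R) (K Q : 'M[C]_m).
Hypothesis t0 : 0 < t.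
Hypothesis Kt : K + adjmx K = (2 * t)%:C%:M.
Hypothesis KQ : K *m Q = 1%:M.

Lemma normc_conj_mul (z : C) : Num.conj z * z = (normc z ^+ 2)%:C.
Proof. by rewrite mulrC -normCK normc_def -rmorphXn; case: z. Qed.

(** Sandwiching [K + K^* = 2 t] between [Q^*] and [Q] gives [2 t Q^* Q = Q + Q^*], whose [(b, b)]
    entry reads [t S = Re Q_bb]. Since [(Re Q_bb)^2 <= S], it follows that [t^2 S^2 <= S]. *)
Lemma resolvent_col_le b : \sum_a normc (Q a b) ^+ 2 <= (t ^+ 2)^-1.
Proof.
set S := \sum_a _.
have S0 : 0 <= S by rewrite sumr_ge0// => a _; rewrite sqr_ge0.
have tS : t * S = complex.Re (Q b b).
  have : adjmx Q *m (2 * t)%:C%:M *m Q = adjmx Q + Q.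
    rewrite -Kt mulmxDr mulmxDl -mulmxA KQ mulmx1 -adjmxM KQ.
    by rewrite /adjmx map_mx1 trmx1 mul1mx.
  move=> /matrixP/(_ b b); rewrite mul_mx_scalar -scalemxAl mxE.
  rewrite [in RHS]mxE [in RHS]mxE [in RHS]mxE addrC.
  rewrite (_ : (adjmx Q *m Q) b b = S%:C); last first.
    rewrite mxE /S rmorph_sum /=; apply: eq_bigr => a _.
    by rewrite !mxE normc_conj_mul.
  rewrite addcJ -rmorphM (_ : 2%:R = (2 : R)%:C) -?rmorphM; last by rewrite rmorph_nat.
  by move=> /complexI; rewrite -mulrA => /mulfI; apply; rewrite pnatr_eq0.
have Qb : complex.Re (Q b b) ^+ 2 <= S.
  rewrite /S (bigD1 b)//= -[leLHS]addr0 lerD//; last first.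
    by rewrite sumr_ge0// => a _; rewrite sqr_ge0.
  by rewrite -(real_normK (num_real _)) lerXn2r ?nnegrE ?normr_ge0 ?normc_ge0// Re_le_normc.
have [->|Sn0] := eqVneq S 0; first by rewrite invr_ge0 sqr_ge0.
have Sgt : 0 < S by rewrite lt_def Sn0.
rewrite -(ler_pM2l Sgt) -(ler_pM2l (exprn_gt0 2 t0)).
rewrite [leRHS]mulrCA mulfV ?mulr1 ?expf_neq0 ?gt_eqF//.
by move: Qb; rewrite -tS exprMn (expr2 S).
Qed.

Lemma resolvent_entry_le a b : normc (Q a b) <= t^-1.
Proof.
rewrite -(@ler_pXn2r _ 2) ?nnegrE ?normc_ge0 ?invr_ge0 ?(ltW t0)// exprVn.
apply: (le_trans _ (resolvent_col_le b)).
rewrite (bigD1 a)//= lerDl sumr_ge0// => ? _; exact: sqr_ge0.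
Qed.

Lemma resolvent_norm1mx_le : norm1mx Q <= (m * m)%:R / t.
Proof.
apply: (@le_trans _ _ (\sum_(i < m) \sum_(j < m) t^-1)).
  by rewrite ler_sum// => i _; rewrite ler_sum// => j _; exact: resolvent_entry_le.
by rewrite !sumr_const !card_ord -mulrnA -[leLHS]mulr_natl.
Qed.

End Bound.

Section Derivative.
Variables (K : R -> 'M[C]_m) (S : 'M[C]_m) (c : R).
Hypothesis KS : forall z z', K z' - K z = (z' - z)%:C *: S.
Hypothesis Ku : forall z, K z \in unitmx.
Let Q z := invmx (K z).
Hypothesis Qc : forall z, norm1mx (Q z) <= c.

Definition dir_trace (S Q : 'M[C]_m) : R := complex.Re (\tr (S *m Q)).
Definition dir_trace_deriv (S Q : 'M[C]_m) : R := - complex.Re (\tr (S *m Q *m S *m Q)).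

Let c0 : 0 <= c. Proof. exact: le_trans (norm1mx_ge0 _) (Qc 0). Qed.

(** The resolvent identity, exact because [K] is affine in [z]. *)
Let QB z z' : Q z' - Q z = - ((z' - z)%:C *: (Q z' *m S *m Q z)).
Proof.
have -> : Q z' - Q z = Q z' *m (K z - K z') *m Q z.
  by rewrite mulmxBr mulmxBl mulVmx// mul1mx -mulmxA mulmxV// mulmx1.
by rewrite -opprB KS mulmxN mulNmx -scalemxAr -scalemxAl.
Qed.

Let norm1mxM4 (A B D E : 'M[C]_m) (a b d e : R) :
  norm1mx A <= a -> norm1mx B <= b -> norm1mx D <= d -> norm1mx E <= e ->
  norm1mx (A *m B *m D *m E) <= a * b * d * e.
Proof.
move=> Aa Bb Dd Ee.
do 3![apply: (le_trans (norm1mxM _ _)); apply: ler_pM => //; rewrite ?norm1mx_ge0//].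
Qed.

(** Using the resolvent identity twice, the first-order remainder is exactly
    [(z' - z)^2 Re tr (S Q(z') S Q(z) S Q(z))], bounded through [c]. *)
Lemma is_derive_dir_trace z : is_derive z (1 : R) (fun z => dir_trace S (Q z)) (dir_trace_deriv S (Q z)).
Proof.
apply: (@is_derive_quadratic _ _ _ _ (norm1mx S * c * (norm1mx S * c) * norm1mx S * c)) => z'.
rewrite /dir_trace /dir_trace_deriv -ReB -raddfB /= -mulmxBr QB.
rewrite mulmxN -scalemxAr !mulmxA raddfN /= linearZ /= ReN ReZ.
rewrite mulrN opprK addrC -mulrBr -ReB -raddfB /= -mulmxBl -mulmxBl -mulmxBr.
rewrite -(opprB (Q z')) QB opprK -scalemxAr -!scalemxAl linearZ /= ReZ !mulmxA.
rewrite [X in `|X|]mulrA -(expr2 (z' - z)) normrM mulrC.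
rewrite (ger0_norm (sqr_ge0 _)) ler_wpM2r ?sqr_ge0//.
rewrite (le_trans (Re_tr_le_norm1mx _))//.
do 2![apply: (le_trans (norm1mxM _ _)); apply: ler_pM => //; rewrite ?norm1mx_ge0//].
by rewrite mulrA; exact: norm1mxM4.
Qed.

(** Lipschitz: the difference of the two quadratic traces splits into two terms with one factor
    [Q z' - Q z] each, which is of order [z' - z]. *)
Lemma continuous_dir_trace_deriv : continuous (fun z => dir_trace_deriv S (Q z)).
Proof.
apply: (@lipschitz_continuous _ _ (2 * (norm1mx S * c * norm1mx S * c * norm1mx S * c))) => z z'.
rewrite /dir_trace_deriv -opprD normrN -ReN -ReD mxtrace_quad_sub.
have B w : `|complex.Re (\tr (S *m (Q z' - Q z) *m S *m Q w))| <=
    norm1mx S * c * norm1mx S * c * norm1mx S * c * `|z' - z|.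
  rewrite QB mulmxN -scalemxAr !mulNmx -!scalemxAl raddfN /= linearZ /= ReN ReZ !mulmxA.
  rewrite normrN normrM mulrC ler_wpM2r// (le_trans (Re_tr_le_norm1mx _))//.
  do 2![apply: (le_trans (norm1mxM _ _)); apply: ler_pM => //; rewrite ?norm1mx_ge0//].
  exact: norm1mxM4.
rewrite ReD (le_trans (ler_normD _ _))//.
apply: (le_trans (lerD (B _) (B _))).
by rewrite -mulr2n -[leLHS]mulr_natl [leLHS]mulrA.
Qed.

Lemma dir_trace_le z : `|dir_trace S (Q z)| <= norm1mx S * c.
Proof.
rewrite /dir_trace (le_trans (Re_tr_le_norm1mx _))// (le_trans (norm1mxM _ _))//.
by rewrite ler_wpM2l// norm1mx_ge0.
Qed.

Lemma dir_trace_deriv_le z : `|dir_trace_deriv S (Q z)| <= norm1mx S * c * norm1mx S * c.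
Proof.
by rewrite /dir_trace_deriv normrN (le_trans (Re_tr_le_norm1mx _))// norm1mxM4.
Qed.

End Derivative.
End SkewResolvent.

(** * Measurability of resolvents *)

Section ComplexMeasurable.
Context d (T : measurableType d) (R : realType).
Local Notation C := R[i].
Local Open Scope complex_scope.

(** Componentwise, so that no sigma-algebra on [R[i]] has to be fixed. *)
Definition cmeasurable (f : T -> C) :=
  measurable_fun setT (fun w => complex.Re (f w)) /\
  measurable_fun setT (fun w => complex.Im (f w)).

Lemma cmeasurable_cst (c : C) : cmeasurable (fun=> c).
Proof. by split; exact: measurable_cst. Qed.

Lemma cmeasurable_real (f : T -> R) :
  measurable_fun setT f -> cmeasurable (fun w => (f w)%:C).
Proof. by split => //=; exact: measurable_cst. Qed.

Lemma cmeasurableD (f g : T -> C) :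
  cmeasurable f -> cmeasurable g -> cmeasurable (fun w => f w + g w).
Proof.
move=> [fr fi] [gr gi]; split.
  rewrite (_ : (fun w => _) = (fun w => complex.Re (f w) + complex.Re (g w))).
    exact: measurable_funD.
  by apply/funext => w; case: (f w); case: (g w).
rewrite (_ : (fun w => _) = (fun w => complex.Im (f w) + complex.Im (g w))).
  exact: measurable_funD.
by apply/funext => w; case: (f w); case: (g w).
Qed.

Lemma cmeasurableM (f g : T -> C) :
  cmeasurable f -> cmeasurable g -> cmeasurable (fun w => f w * g w).
Proof.
move=> [fr fi] [gr gi]; split.
  rewrite (_ : (fun w => _) = (fun w =>
      complex.Re (f w) * complex.Re (g w) - complex.Im (f w) * complex.Im (g w))).
    by apply: measurable_funB; exact: measurable_funM.
  by apply/funext => w; case: (f w); case: (g w).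
rewrite (_ : (fun w => _) = (fun w =>
    complex.Re (f w) * complex.Im (g w) + complex.Im (f w) * complex.Re (g w))).
  by apply: measurable_funD; exact: measurable_funM.
by apply/funext => w; case: (f w) => a b; case: (g w) => a' b'.
Qed.

Lemma cmeasurableV (f : T -> C) : cmeasurable f -> cmeasurable (fun w => (f w)^-1).
Proof.
move=> [fr fi].
have mn : measurable_fun setT
    (fun w => (complex.Re (f w) ^+ 2 + complex.Im (f w) ^+ 2)^-1).
  (* The inverse is written as the real power of exponent [-1], which is measurable; the two agree
     for every nonnegative base, including 0. *)
  rewrite (_ : (fun w => _) = fun w =>
      (complex.Re (f w) ^+ 2 + complex.Im (f w) ^+ 2) `^ (-1)); last first.
    by apply/funext => w; rewrite powR_inv1// addr_ge0// sqr_ge0.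
  apply: (measurableT_comp (measurable_powR _)).
  by apply: measurable_funD; exact: measurable_funX.
split.
  rewrite (_ : (fun w => _) = (fun w => complex.Re (f w) *
      (complex.Re (f w) ^+ 2 + complex.Im (f w) ^+ 2)^-1)).
    exact: measurable_funM.
  by apply/funext => w; case: (f w).
rewrite (_ : (fun w => _) = (fun w => - complex.Im (f w) *
    (complex.Re (f w) ^+ 2 + complex.Im (f w) ^+ 2)^-1)).
  by apply: measurable_funM => //; exact: measurableT_comp.
by apply/funext => w; case: (f w) => a b /=; rewrite mulNr.
Qed.

Lemma cmeasurable_sum (I : Type) (r : seq I) (F : I -> T -> C) :
  (forall i, cmeasurable (F i)) -> cmeasurable (fun w => \sum_(i <- r) F i w).
Proof.
move=> mF; elim: r => [|i r IH].
  under eq_fun do rewrite big_nil; exact: cmeasurable_cst.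
by under eq_fun do rewrite big_cons; exact: cmeasurableD.
Qed.

Lemma cmeasurable_prod (I : Type) (r : seq I) (F : I -> T -> C) :
  (forall i, cmeasurable (F i)) -> cmeasurable (fun w => \prod_(i <- r) F i w).
Proof.
move=> mF; elim: r => [|i r IH].
  under eq_fun do rewrite big_nil; exact: cmeasurable_cst.
by under eq_fun do rewrite big_cons; exact: cmeasurableM.
Qed.

Lemma cmeasurable_det m (M : T -> 'M[C]_m) :
  (forall i j, cmeasurable (fun w => M w i j)) -> cmeasurable (fun w => \det (M w)).
Proof.
move=> mM; apply: cmeasurable_sum => s; apply: cmeasurableM.
  exact: cmeasurable_cst.
by apply: cmeasurable_prod.
Qed.

(** Cramer's rule: entries of the inverse are cofactors over the determinant, all polynomial in the
    entries up to one division. *)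
Lemma cmeasurable_invmx m (M : T -> 'M[C]_m) i j :
  (forall w, M w \in unitmx) ->
  (forall i j, cmeasurable (fun w => M w i j)) ->
  cmeasurable (fun w => invmx (M w) i j).
Proof.
move=> uM mM; rewrite (_ : (fun w => _) = fun w =>
  (\det (M w))^-1 * ((-1) ^+ (j + i) * \det (row' j (col' i (M w))))); last first.
  by apply/funext => w; rewrite /invmx uM !mxE.
apply: cmeasurableM; first exact/cmeasurableV/cmeasurable_det.
apply: cmeasurableM; first exact: cmeasurable_cst.
apply: cmeasurable_det => k l.
by rewrite (_ : (fun w => _) = fun w => M w (lift j k) (lift i l))//; apply/funext => w; rewrite !mxE.
Qed.

Lemma cmeasurable_mulmx m n p (A : T -> 'M[C]_(m, n)) (B : T -> 'M[C]_(n, p)) :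
  (forall i j, cmeasurable (fun w => A w i j)) ->
  (forall i j, cmeasurable (fun w => B w i j)) ->
  forall i j, cmeasurable (fun w => (A w *m B w) i j).
Proof.
move=> mA mB i j; under eq_fun do rewrite mxE.
by apply: cmeasurable_sum => k; exact: cmeasurableM.
Qed.

Lemma cmeasurable_trace m (A : T -> 'M[C]_m) :
  (forall i j, cmeasurable (fun w => A w i j)) -> cmeasurable (fun w => \tr (A w)).
Proof. by move=> mA; apply: cmeasurable_sum. Qed.

End ComplexMeasurable.

(** * Resolvents of Gaussian combinations of fixed matrices *)

Section Model.
Context {R : realType} {n : nat} {I : finType} (E : I -> 'M[R[i]]_n) (t : R).
Local Notation C := R[i].
Local Open Scope complex_scope.
Hypothesis t0 : 0 < t.

Definition skew_block (A : 'M[C]_n) : 'M[C]_(n + n) := block_mx 0 A (- adjmx A) 0.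

(** One model serves both ensembles: [E] will be the matrix units in the real case, and the matrix
    units with their multiples by ['i] in the complex case. *)
Definition linear_mx (x : I -> R) : 'M[C]_n := \sum_k (x k)%:C *: E k.

Definition resolvent (x : I -> R) : 'M[C]_(n + n) := invmx (dilation t (linear_mx x)).

Definition trace_resolvent (Z : 'M[C]_n) : R := \sum_j t / (t ^+ 2 + gram_eig Z j).

Lemma adjmxD m (A B : 'M[C]_m) : adjmx (A + B) = adjmx A + adjmx B.
Proof. by rewrite /adjmx map_mxD raddfD. Qed.

Lemma adjmxZ m (a : R) (A : 'M[C]_m) : adjmx (a%:C *: A) = a%:C *: adjmx A.
Proof.
by apply/matrixP => i j; rewrite !mxE rmorphM /= (conjE a%:C) conjc_real.
Qed.

Lemma skew_blockD : {morph skew_block : A B / A + B}.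
Proof.
by move=> A B; rewrite /skew_block add_block_mx !addr0 adjmxD opprD.
Qed.

Lemma skew_blockZ (a : R) A : skew_block (a%:C *: A) = a%:C *: skew_block A.
Proof. by rewrite /skew_block scale_block_mx !scaler0 adjmxZ scalerN. Qed.

Lemma skew_block0 : skew_block 0 = 0.
Proof.
by rewrite -(scale0r 0) (_ : 0 = (0 : R)%:C)// skew_blockZ scale0r.
Qed.

Lemma dilation_linear_mx x :
  dilation t (linear_mx x) = t%:C%:M + \sum_k (x k)%:C *: skew_block (E k).
Proof.
have -> : \sum_k (x k)%:C *: skew_block (E k) = skew_block (linear_mx x).
  rewrite /linear_mx (big_morph _ skew_blockD skew_block0).
  by apply: eq_bigr => k _; rewrite skew_blockZ.
rewrite /dilation /skew_block scalar_mx_block add_block_mx.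
by rewrite !addr0 !add0r.
Qed.

Lemma dilation_skew (Z : 'M[C]_n) : dilation t Z + adjmx (dilation t Z) = (2 * t)%:C%:M.
Proof.
have -> : adjmx (dilation t Z) = block_mx t%:C%:M (- Z) (adjmx Z) t%:C%:M.
  rewrite /dilation /adjmx map_block_mx tr_block_mx map_mxN raddfN /=.
  rewrite -/(adjmx (adjmx Z)) -/(adjmx Z) adjmxK map_scalar_mx tr_scalar_mx /=.
  by rewrite (conjE t%:C) conjc_real.
rewrite add_block_mx subrr addNr -!raddfD /= [RHS]scalar_mx_block.
by rewrite mulrDl mul1r.
Qed.

Lemma dilation_unit (Z : 'M[C]_n) : dilation t Z \in unitmx.
Proof.
have [Q [/mulmx1_unit[]]] := dilation_inv Z t0.
by [].
Qed.

Lemma resolventP x : dilation t (linear_mx x) *m resolvent x = 1%:M.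
Proof. by rewrite mulmxV// dilation_unit. Qed.

Lemma tr_resolvent x :
  \tr (ulsubmx (resolvent x)) = (trace_resolvent (linear_mx x))%:C /\
  \tr (drsubmx (resolvent x)) = (trace_resolvent (linear_mx x))%:C.
Proof.
have [Q [KQ tu td]] := dilation_inv (linear_mx x) t0.
suff -> : resolvent x = Q by [].
by rewrite -[LHS]mulmx1 -KQ mulmxA mulVmx ?mul1mx// dilation_unit.
Qed.

Lemma dilation_upd (x : I -> R) k z z' :
  dilation t (linear_mx (upd x k z')) - dilation t (linear_mx (upd x k z)) =
  (z' - z)%:C *: skew_block (E k).
Proof.
rewrite !dilation_linear_mx opprD addrACA subrr add0r -sumrB (bigD1 k)//= big1 ?addr0.
  by rewrite /upd eqxx -scalerBl rmorphB.
by move=> j jk; rewrite /upd (negbTE jk) subrr.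
Qed.

Definition coord_trace k (x : I -> R) := dir_trace (skew_block (E k)) (resolvent x).
Definition coord_trace_deriv k (x : I -> R) := dir_trace_deriv (skew_block (E k)) (resolvent x).

(** The dilation is [K = t + sum_k x_k S_k], so the sum is [Re tr ((K - t) Q) = Re tr (1 - t Q)]. *)
Lemma sum_coord_trace x :
  \sum_k x k * coord_trace k x = 2 * n%:R - 2 * t * trace_resolvent (linear_mx x).
Proof.
set Q := resolvent x; set tau := trace_resolvent _.
have trQ : \tr Q = (2 * tau)%:C.
  have [tu td] := tr_resolvent x.
  by rewrite -(submxK Q) mxtrace_block tu td -rmorphD /= mulrDl mul1r.
have SQ : (\sum_k (x k)%:C *: skew_block (E k)) *m Q = 1%:M - t%:C *: Q.
  apply/eqP; rewrite eq_sym subr_eq addrC -mul_scalar_mx -mulmxDl -dilation_linear_mx.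
  by rewrite resolventP.
have : complex.Re (\tr ((\sum_k (x k)%:C *: skew_block (E k)) *m Q)) =
       \sum_k x k * coord_trace k x.
  rewrite mulmx_suml [\tr _]raddf_sum /=.
  rewrite Re_sum; apply: eq_bigr => k _.
  by rewrite -scalemxAl mxtraceZ ReZ.
move=> <-; rewrite SQ raddfB /= mxtrace1 mxtraceZ trQ -rmorphM.
rewrite (_ : (n + n)%:R = (2 * n%:R : R)%:C); last first.
  by rewrite rmorphM /= !rmorph_nat -natrM mul2n addnn.
by rewrite -rmorphB /=; ring.
Qed.

Let c := ((n + n) * (n + n))%:R / t.

Lemma norm1mx_resolvent x : norm1mx (resolvent x) <= c.
Proof. exact: resolvent_norm1mx_le t0 (dilation_skew _) (resolventP x). Qed.

Lemma measurable_resolvent i j :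
  cmeasurable (fun x : vect I R => resolvent x i j).
Proof.
apply: cmeasurable_invmx => [x|k l]; first exact: dilation_unit.
have mD : forall k, cmeasurable (fun x : vect I R => (x k)%:C).
  by move=> ?; apply: cmeasurable_real; exact: measurable_coord.
have -> : (fun x : vect I R => dilation t (linear_mx x) k l) =
    (fun x : vect I R => (t%:C%:M : 'M[C]_(n + n)) k l + \sum_h (x h)%:C * skew_block (E h) k l).
  apply/funext => x; rewrite dilation_linear_mx mxE summxE; congr (_ + _).
  by apply: eq_bigr => h _; rewrite mxE.
apply: cmeasurableD; first exact: cmeasurable_cst.
by apply: cmeasurable_sum => h; apply: cmeasurableM => //; exact: cmeasurable_cst.
Qed.

Lemma measurable_coord_trace k : measurable_fun setT (coord_trace k : vect I R -> R).
Proof.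
suff [] : cmeasurable (fun x : vect I R => \tr (skew_block (E k) *m resolvent x)) by [].
apply: cmeasurable_trace; apply: cmeasurable_mulmx => [i j|i j].
  exact: cmeasurable_cst.
exact: measurable_resolvent.
Qed.

Lemma measurable_coord_trace_deriv k : measurable_fun setT (coord_trace_deriv k : vect I R -> R).
Proof.
suff [m _] : cmeasurable (fun x : vect I R =>
    \tr (skew_block (E k) *m resolvent x *m skew_block (E k) *m resolvent x)).
  exact: measurableT_comp.
have mQ := measurable_resolvent.
have mS i j : cmeasurable (fun x : vect I R => skew_block (E k) i j).
  exact: cmeasurable_cst.
by apply: cmeasurable_trace; do 3![apply: cmeasurable_mulmx => //].
Qed.

Section Expectation.
Context d (T : measurableType d) (P : probability T R).
Context (X : I -> {RV P >-> R}) (s : R).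
Hypothesis s0 : 0 < s.
Hypothesis indX : mutually_independent P (fun i => (X i : T -> R)).
Hypothesis lawX : forall k, has_normal_law P (X k) 0 s.

Let XX (w : T) : vect I R := fun i => X i w.

(** The integration by parts takes a single constant for the function and its derivative. *)
Let B k :=
  Num.max (norm1mx (skew_block (E k)) * c)
          (norm1mx (skew_block (E k)) * c * norm1mx (skew_block (E k)) * c).

Let Ku k x z : dilation t (linear_mx (upd x k z)) \in unitmx.
Proof. exact: dilation_unit. Qed.

Let Qc k x z : norm1mx (invmx (dilation t (linear_mx (upd x k z)))) <= c.
Proof. exact: norm1mx_resolvent. Qed.

Let upd_id k (x : I -> R) : upd x k (x k) = x.
Proof. by apply/funext => j; rewrite /upd; case: eqP => [->|]. Qed.

Let fB k x : `|coord_trace k x| <= B k.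
Proof.
rewrite /B le_max; apply/orP; left.
by have := dir_trace_le (skew_block (E k)) (Qc k x) (x k); rewrite upd_id.
Qed.

Let gB k x : `|coord_trace_deriv k x| <= B k.
Proof.
rewrite /B le_max; apply/orP; right.
by have := dir_trace_deriv_le (skew_block (E k)) (Qc k x) (x k); rewrite upd_id.
Qed.

Lemma expectation_coord_trace k :
  (\int[P]_w (X k w * coord_trace k (XX w))%:E = \int[P]_w (s ^+ 2 * coord_trace_deriv k (XX w))%:E)%E.
Proof.
apply: (integral_stein s0 indX (lawX k) (measurable_coord_trace k)
  (measurable_coord_trace_deriv k) (fB k) (gB k)).
- by move=> x z; apply: (is_derive_dir_trace (dilation_upd x k) (Ku k x) (Qc k x)).
- by move=> x; exact: (continuous_dir_trace_deriv (dilation_upd x k) (Ku k x) (Qc k x)).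
Qed.

Let intg k : P.-integrable setT (fun w => (s ^+ 2 * coord_trace_deriv k (XX w))%:E).
Proof. exact: (integrable_stein_r X s (measurable_coord_trace_deriv k) (fB k) (gB k)). Qed.

Lemma integrable_sum_coord_trace_deriv :
  P.-integrable setT (fun w => (s ^+ 2 * \sum_k coord_trace_deriv k (XX w))%:E).
Proof.
under eq_fun do rewrite mulr_sumr -sumEFin.
exact: integrable_sum.
Qed.

(** The Stein identities of all coordinates are added; on the left the sum collapses by
    [sum_coord_trace]. *)
Lemma expectation_trace_resolvent :
  (\int[P]_w (2 * n%:R - 2 * t * trace_resolvent (linear_mx (XX w)))%:E =
   \int[P]_w (s ^+ 2 * \sum_k coord_trace_deriv k (XX w))%:E)%E.
Proof.
under eq_integral do rewrite -sum_coord_trace -sumEFin.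
under [RHS]eq_integral do rewrite mulr_sumr -sumEFin.
have intf k : P.-integrable setT (fun w => (X k w * coord_trace k (XX w))%:E).
  exact: (integrable_stein_l s0 (lawX k) (measurable_coord_trace k) (fB k)).
rewrite !integral_sum//.
by apply: eq_bigr => k _; exact: expectation_coord_trace.
Qed.

End Expectation.

End Model.

(** * Summing over the coordinates of a Ginibre matrix *)

Section RankTwo.
Context {F : comNzRingType} {m : nat}.
Implicit Types (Q : 'M[F]_m).

Lemma tr_delta_mul (a b : 'I_m) Q : \tr (delta_mx a b *m Q) = Q b a.
Proof.
rewrite /mxtrace (bigD1 a)//= big1 ?addr0.
  rewrite mxE (bigD1 b)//= big1 ?addr0; first by rewrite mxE !eqxx mul1r.
  by move=> k kb; rewrite mxE (negbTE kb) andbF mul0r.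
move=> i ia; rewrite mxE big1// => k _.
by rewrite mxE (negbTE ia) mul0r.
Qed.

Lemma mul_delta_mulE (a b c d : 'I_m) (M N : 'M[F]_m) :
  (M *m delta_mx a b *m N) c d = M c a * N b d.
Proof.
rewrite mxE (bigD1 b)//= big1 ?addr0.
  rewrite mxE (bigD1 a)//= big1 ?addr0; first by rewrite mxE !eqxx mulr1.
  by move=> k ka; rewrite mxE (negbTE ka) mulr0.
move=> k kb; rewrite mxE big1 ?mul0r// => i _.
by rewrite mxE (negbTE kb) andbF mulr0.
Qed.

Lemma tr_delta2 (a b c d : 'I_m) Q :
  \tr (delta_mx a b *m Q *m delta_mx c d *m Q) = Q b c * Q d a.
Proof. by rewrite -!mulmxA tr_delta_mul mulmxA mul_delta_mulE. Qed.

(** [S] has the shape of a skew block in a single coordinate direction. Of the four products of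
    matrix units, the two mixed ones both contribute [Q a a * Q b b]. *)
Lemma tr_rank2 (a b : 'I_m) (u v : F) Q :
  let S := u *: delta_mx a b - v *: delta_mx b a in
  \tr (S *m Q *m S *m Q) =
  u ^+ 2 * Q b a ^+ 2 + v ^+ 2 * Q a b ^+ 2 - 2 * (u * v) * (Q a a * Q b b).
Proof.
move=> S.
have expand (x y : 'M[F]_m) : (x - y) *m Q *m (x - y) *m Q =
    x *m Q *m x *m Q - y *m Q *m x *m Q - (x *m Q *m y *m Q - y *m Q *m y *m Q).
  by rewrite mulmxBl mulmxBr !mulmxBl.
have trB (w x y z : 'M[F]_m) :
    \tr (w - x - (y - z)) = \tr w - \tr x - (\tr y - \tr z).
  by rewrite !raddfB.
have tr4 (p q : F) (x y : 'M[F]_m) :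
    \tr ((p *: x) *m Q *m (q *: y) *m Q) = p * q * \tr (x *m Q *m y *m Q).
  by rewrite -!scalemxAl -scalemxAr -scalemxAl scalerA mxtraceZ.
rewrite /S expand trB !tr4 !tr_delta2.
by ring.
Qed.

End RankTwo.

Section Ginibre.
Context {R : realType} {n : nat}.
Local Notation C := R[i].
Local Open Scope complex_scope.

Lemma skew_block_delta (u : C) (i j : 'I_n) :
  skew_block (u *: delta_mx i j) =
  u *: delta_mx (lshift n i) (rshift n j) - u^* *: delta_mx (rshift n j) (lshift n i).
Proof.
apply/matrixP => k l; rewrite /skew_block !mxE.
case: split_ordP => k' ->; rewrite !mxE; case: split_ordP => l' ->; rewrite !mxE;
  rewrite ?(inj_eq (@lshift_inj _ _)) ?(inj_eq (@rshift_inj _ _)) ?eq_lrshift ?eq_rlshift /=.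
- by rewrite andbF !mulr0 subr0.
- by rewrite mulr0 subr0.
- by rewrite mulr0 sub0r rmorphM rmorph_nat /= andbC.
- by rewrite andbF !mulr0 subr0.
Qed.

Lemma dir_trace_deriv_delta (u : C) (i j : 'I_n) (Q : 'M[C]_(n + n)) :
  dir_trace_deriv (skew_block (u *: delta_mx i j)) Q =
  complex.Re (2 * (u * u^*) * (Q (lshift n i) (lshift n i) * Q (rshift n j) (rshift n j))
    - u ^+ 2 * Q (rshift n j) (lshift n i) ^+ 2
    - (u^*) ^+ 2 * Q (lshift n i) (rshift n j) ^+ 2).
Proof.
rewrite /dir_trace_deriv skew_block_delta -ReN; congr complex.Re.
by rewrite tr_rank2; ring.
Qed.

Section Sums.
Variables (Q : 'M[C]_(n + n)) (tau : R).
Hypothesis tu : \tr (ulsubmx Q) = tau%:C.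
Hypothesis td : \tr (drsubmx Q) = tau%:C.

Let sum_diag : \sum_(i < n) \sum_(j < n)
   Q (lshift n i) (lshift n i) * Q (rshift n j) (rshift n j) = (tau ^+ 2)%:C.
Proof.
rewrite expr2 rmorphM /= -[in X in X * _]tu -[in X in _ * X]td /mxtrace.
rewrite mulr_suml; apply: eq_bigr => i _; rewrite mulr_sumr; apply: eq_bigr => j _.
by rewrite !mxE.
Qed.

(** The products of diagonal entries sum to [tau^2]. The squares of off-diagonal entries do not
    cancel, but are bounded by the total of [|Q_ab|^2], at most [t^-2] for each of the [2 n]
    columns. *)
Lemma sum_dir_trace_deriv_real (t : R) :
  (forall b, \sum_a normc (Q a b) ^+ 2 <= (t ^+ 2)^-1) ->
  2 * tau ^+ 2 - 2 * n%:R / t ^+ 2 <=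
  \sum_(k : 'I_n * 'I_n) dir_trace_deriv (skew_block (delta_mx k.1 k.2)) Q.
Proof.
move=> Qb.
have E k : dir_trace_deriv (skew_block (delta_mx k.1 k.2)) Q =
  2 * complex.Re (Q (lshift n k.1) (lshift n k.1) * Q (rshift n k.2) (rshift n k.2))
  - complex.Re (Q (rshift n k.2) (lshift n k.1) ^+ 2)
  - complex.Re (Q (lshift n k.1) (rshift n k.2) ^+ 2).
  rewrite -[delta_mx _ _]scale1r dir_trace_deriv_delta rmorph1 mulr1 expr1n !mul1r !ReB.
  by rewrite mulr1 (_ : 2 = (2 : R)%:C) ?ReZ// rmorph_nat.
have Re2 (z : C) : complex.Re (z ^+ 2) <= normc z ^+ 2.
  by rewrite (le_trans (ler_norm _))// (le_trans (Re_le_normc _))// expr2 normcM -expr2.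
rewrite (eq_bigr _ (fun k _ => E k)) !sumrB -mulr_sumr -Re_sum.
rewrite -(pair_bigA _ (fun i j => Q (lshift n i) (lshift n i) * Q (rshift n j) (rshift n j))) /=.
rewrite sum_diag /= -addrA -opprD lerB// -big_split /=.
have : \sum_(b : 'I_(n + n)) \sum_a normc (Q a b) ^+ 2 <= 2 * n%:R / t ^+ 2.
  apply: (@le_trans _ _ (\sum_(b < n + n) (t ^+ 2)^-1)).
    by rewrite ler_sum.
  by rewrite sumr_const card_ord addnn -mul2n -[leLHS]mulr_natl natrM.
apply: le_trans.
(* The left columns pay for the lower-left block and the right columns for the upper-right one; the
   diagonal blocks are dropped. *)
rewrite big_split_ord /= big_split /= lerD//.
- rewrite -(pair_bigA _ (fun i j => complex.Re (Q (rshift n j) (lshift n i) ^+ 2))) /=.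
  rewrite ler_sum// => i _; rewrite big_split_ord /= -[leLHS]add0r lerD//.
    by rewrite sumr_ge0// => k _; exact: sqr_ge0.
  by rewrite ler_sum.
- rewrite -(pair_bigA _ (fun i j => complex.Re (Q (lshift n i) (rshift n j) ^+ 2))) /=.
  rewrite exchange_big ler_sum//= => i _; rewrite big_split_ord /= -[leLHS]addr0 lerD//.
    by rewrite ler_sum.
  by rewrite sumr_ge0// => k _; exact: sqr_ge0.
Qed.

(** For [v = 1] and [u = 'i] the squares of off-diagonal entries carry the opposite factors [v^2]
    and [u^2] and cancel. This is why the complex case has no error term. *)
Lemma dir_trace_deriv_complex_pair (v u : C) (i j : 'I_n) :
  Num.conj v = v -> v ^+ 2 = 1 -> Num.conj u = - u -> u ^+ 2 = -1 ->
  dir_trace_deriv (skew_block (v *: delta_mx i j)) Q + dir_trace_deriv (skew_block (u *: delta_mx i j)) Q =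
  4 * complex.Re (Q (lshift n i) (lshift n i) * Q (rshift n j) (rshift n j)).
Proof.
move=> cv v2 cu u2.
rewrite (dir_trace_deriv_delta v) (dir_trace_deriv_delta u).
rewrite cv cu -ReD -ReZ; congr complex.Re.
move: (Q (lshift n i) (lshift n i)) (Q (rshift n j) (rshift n j))
      (Q (lshift n i) (rshift n j)) (Q (rshift n j) (lshift n i)) => x y z w.
have -> : 4%:C = 4 :> C by rewrite rmorph_nat.
by rewrite mulrN sqrrN -!expr2 u2 v2; ring.
Qed.

Lemma sum_dir_trace_deriv_complex :
  \sum_(k : bool * ('I_n * 'I_n))
    dir_trace_deriv (skew_block ((if k.1 then 1 else 'i) *: delta_mx k.2.1 k.2.2)) Q =
  4 * tau ^+ 2.
Proof.
pose G b k := dir_trace_deriv (skew_block ((if b then 1 else 'i) *: delta_mx k.1 k.2)) Q.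
rewrite -(pair_bigA _ G) big_bool -big_split.
have E k : G true k + G false k =
    4 * complex.Re (Q (lshift n k.1) (lshift n k.1) * Q (rshift n k.2) (rshift n k.2)).
  apply: dir_trace_deriv_complex_pair; [exact: rmorph1|exact: expr1n| |exact: sqr_i].
  by rewrite conjE /conjc; congr Complex; rewrite oppr0.
rewrite (eq_bigr _ (fun k _ => E k)) -mulr_sumr -Re_sum.
rewrite -(pair_bigA _ (fun i j => Q (lshift n i) (lshift n i) * Q (rshift n j) (rshift n j))) /=.
by rewrite sum_diag.
Qed.

End Sums.

End Ginibre.

(** * Riemann sums *)

Section Quadrature.
Context {R : realType}.

Lemma le_increment (F f : R -> R) (a b : R) :
  (forall x, is_derive x (1 : R) F (f x)) ->
  (forall x y : R, 0 <= x -> x <= y -> f y <= f x) ->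
  0 <= a -> a <= b ->
  f b * (b - a) <= F b - F a /\ F b - F a <= f a * (b - a).
Proof.
move=> dF fdec a0 ab.
have [c /[!in_itv]/=/andP[ac cb] ->] : exists2 c, c \in `[a, b] & F b - F a = f c * (b - a).
  apply: MVT_segment => //.
  by apply: derivable_within_continuous => z _; exact: ex_derive.
have c0 : 0 <= c by exact: le_trans ac.
by split; rewrite ler_wpM2r ?subr_ge0// fdec//.
Qed.

Lemma right_sum_le (F f : R -> R) (D : R) (N : nat) :
  (forall x, is_derive x (1 : R) F (f x)) ->
  (forall x y : R, 0 <= x -> x <= y -> f y <= f x) -> 0 <= D ->
  \sum_(k < N) D * f (k.+1%:R * D) <= F (N%:R * D) - F 0.
Proof.
move=> dF fdec D0; elim: N => [|N IH]; first by rewrite big_ord0 mul0r subrr.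
rewrite big_ord_recr /=.
have ND0 : 0 <= N%:R * D by rewrite mulr_ge0.
have NSD : N%:R * D <= N.+1%:R * D by rewrite ler_wpM2r// ler_nat.
have [H _] := le_increment dF fdec ND0 NSD.
have {}H : D * f (N.+1%:R * D) <= F (N.+1%:R * D) - F (N%:R * D).
  move: H; rewrite -mulrBl mulrC; have -> : N.+1%:R - N%:R = 1 :> R by rewrite -natrB// subSnn.
  by rewrite mul1r.
by apply: (le_trans (lerD IH H)); rewrite addrC addrA subrK.
Qed.

Lemma right_sum_ge (F f : R -> R) (D : R) (N : nat) :
  (forall x, is_derive x (1 : R) F (f x)) ->
  (forall x y : R, 0 <= x -> x <= y -> f y <= f x) -> 0 <= D ->
  F (N.+1%:R * D) - F D <= \sum_(k < N) D * f (k.+1%:R * D).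
Proof.
move=> dF fdec D0; elim: N => [|N IH]; first by rewrite big_ord0 mul1r subrr.
rewrite big_ord_recr /=.
have ND0 : 0 <= N.+1%:R * D by rewrite mulr_ge0.
have NSD : N.+1%:R * D <= N.+2%:R * D by rewrite ler_wpM2r// ler_nat.
have [_ H] := le_increment dF fdec ND0 NSD.
have {}H : F (N.+2%:R * D) - F (N.+1%:R * D) <= D * f (N.+1%:R * D).
  move: H; rewrite -[X in _ <= _ * X]mulrBl [leRHS]mulrC.
  have -> : N.+2%:R - N.+1%:R = 1 :> R by rewrite -natrB// subSnn.
  by rewrite mul1r.
by apply: (le_trans _ (lerD IH H)); rewrite [leRHS]addrC addrA subrK.
Qed.

(** The summand is [l / (t^2 + l)], decreasing in [t >= 0] with antiderivative
    [sqrt l * atan (t / sqrt l)], and [atan] stays below [pi / 2]. *)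
Lemma sqrt_ge_right_sum (l D : R) (N : nat) : 0 <= l -> 0 <= D ->
  \sum_(k < N) D * (1 - (k.+1%:R * D) ^+ 2 / ((k.+1%:R * D) ^+ 2 + l)) <=
  pi / 2 * Num.sqrt l.
Proof.
move=> l0 D0.
(* The antiderivative divides by [sqrt l]; for [l = 0] all summands vanish. *)
have [->|ln0] := eqVneq l 0.
  rewrite sqrtr0 mulr0 sumr_le0// => k _; rewrite addr0.
  have [->|D1] := eqVneq D 0; first by rewrite mul0r.
  by rewrite divff ?subrr ?mulr0// expf_neq0// mulf_neq0// pnatr_eq0.
have {ln0 l0} l0 : 0 < l by rewrite lt_def ln0.
have s0 : 0 < Num.sqrt l by rewrite sqrtr_gt0.
pose F t := Num.sqrt l * atan (t / Num.sqrt l).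
pose f t := l / (t ^+ 2 + l).
have pos t : 0 < t ^+ 2 + l by rewrite ltr_wpDl// sqr_ge0.
have dF x : is_derive x (1 : R) F (f x).
  rewrite /F; apply: is_derive_eq; rewrite /GRing.scale /= /f.
  have sl : Num.sqrt l ^+ 2 = l by rewrite sqr_sqrtr// ltW.
  have := pos x; have := s0; rewrite -[in l / _]sl -[in X in _ < _ + X]sl.
  move: (Num.sqrt l) => r r0 p.
  by field; rewrite !gt_eqF.
have fdec : (forall x y : R, 0 <= x -> x <= y -> f y <= f x).
  move=> x y x0 xy; rewrite /f ler_wpM2l ?(ltW l0)// lef_pV2 ?posrE// lerD2r.
  by apply: lerXn2r; rewrite ?nnegrE; [|exact: le_trans xy|].
have -> : \sum_(k < N) D * (1 - (k.+1%:R * D) ^+ 2 / ((k.+1%:R * D) ^+ 2 + l)) =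
   \sum_(k < N) D * f (k.+1%:R * D).
  apply: eq_bigr => k _; congr (_ * _); rewrite /f.
  have p := lt0r_neq0 (pos (k.+1%:R * D)).
  by rewrite -[X in X - _](divff p) -mulrBl addrAC subrr add0r.
apply: (le_trans (right_sum_le _ dF fdec D0)).
rewrite /F mul0r atan0 mulr0 subr0 mulrC ler_wpM2r ?(ltW s0)//.
exact/ltW/atan_ltpi2.
Qed.

Lemma sum_inv_sq_le N : \sum_(k < N) (k.+1%:R ^+ 2)^-1 <= 2 :> R.
Proof.
case: N => [|N]; first by rewrite big_ord0.
(* The induction needs this telescoping strengthening of the bound 2. *)
suff : \sum_(k < N.+1) (k.+1%:R ^+ 2)^-1 <= 2 - N.+1%:R^-1 :> R.
  by move=> /le_trans; apply; rewrite gerBl invr_ge0.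
elim: N => [|N IH]; first by rewrite big_ord1 expr1n invr1; lra.
rewrite big_ord_recr /= (le_trans (lerD IH (lexx _)))//.
have x0 : (0 : R) < N.+1%:R by [].
have -> : N.+2%:R = N.+1%:R + 1 :> R by rewrite -natr1.
move: (N.+1%:R) x0 => x x0.
have x1 : 0 < x + 1 by rewrite addr_gt0.
have -> : 2 - x^-1 + ((x + 1) ^+ 2)^-1 = 2 - (x + 1)^-1 - (x * (x + 1) ^+ 2)^-1.
  by field; rewrite !gt_eqF.
by rewrite gerBl invr_ge0 mulr_ge0 ?sqr_ge0// ltW.
Qed.

Let w (t : R) := Num.sqrt (t ^+ 2 + 4).

Let w_sq t : w t ^+ 2 = t ^+ 2 + 4.
Proof. by rewrite sqr_sqrtr// addr_ge0// sqr_ge0. Qed.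

Let w_gt0 t : 0 < w t.
Proof. by rewrite sqrtr_gt0 ltr_wpDl// sqr_ge0. Qed.

(* The quarter-circle Stieltjes profile: the root in [0, 1] of h^2 + t^2 h = t^2. *)
Definition profile (t : R) := (t * w t - t ^+ 2) / 2.

Lemma profileE t : profile t ^+ 2 + t ^+ 2 * profile t = t ^+ 2.
Proof.
have := w_sq t; rewrite /profile; move: (w t) => y y2.
by field: y2.
Qed.

Lemma profile_ge0 t : 0 <= t -> 0 <= profile t.
Proof.
move=> t0; rewrite /profile divr_ge0// expr2 -mulrBr mulr_ge0// subr_ge0.
by rewrite -(ler_pXn2r (n := 2)) ?nnegrE ?(ltW (w_gt0 t))// w_sq lerDl.
Qed.

Lemma profile_le1 t : 0 <= t -> profile t <= 1.
Proof.
move=> t0; have p0 := profile_ge0 t0; have := profileE t.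
move: (profile t) p0 => p p0 pE; rewrite leNgt; apply/negP => p1.
have p2 : 0 < p ^+ 2 by rewrite exprn_gt0// (lt_trans ltr01).
have : t ^+ 2 * 1 <= t ^+ 2 * p by rewrite ler_wpM2l ?sqr_ge0// ltW.
by rewrite mulr1 -[leLHS]pE gerDr leNgt p2.
Qed.

(** With [p], [q] the values at [x], [y], the quadratic equation reads [p^2 = x^2 (1 - p)]. If
    [q < p], then [p^2 <= y^2 (1 - p) <= y^2 (1 - q) = q^2], a contradiction. *)
Lemma profile_nd x y : 0 <= x -> x <= y -> profile x <= profile y.
Proof.
move=> x0 xy; have y0 := le_trans x0 xy.
have p0 := profile_ge0 x0; have q0 := profile_ge0 y0.
have p1 := profile_le1 x0; have := profileE x; have := profileE y.
have : x ^+ 2 <= y ^+ 2 by apply: lerXn2r.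
move: (profile x) (profile y) p0 q0 p1 => p q p0 q0 p1 xxyy qE pE.
rewrite leNgt; apply/negP => qp.
have qp2 : q ^+ 2 < p ^+ 2 by rewrite ltr_pXn2r.
have pX : x ^+ 2 * (1 - p) <= y ^+ 2 * (1 - p) by rewrite ler_wpM2r// subr_ge0.
have qY : y ^+ 2 * (1 - p) <= y ^+ 2 * (1 - q).
  by rewrite ler_wpM2l ?sqr_ge0// lerD2l lerN2 ltW.
have pp : x ^+ 2 * (1 - p) = p ^+ 2 by rewrite mulrBr mulr1 -{1}pE addrK.
have qq : y ^+ 2 * (1 - q) = q ^+ 2 by rewrite mulrBr mulr1 -{1}qE addrK.
by have := le_trans pX qY; rewrite pp qq leNgt qp2.
Qed.

(** Antiderivative of [1 - profile], normalized to vanish at infinity; [H 0 = - 4 / 3] gives the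
    value [4 / 3] of the integral. *)
Let H (t : R) := t + t ^+ 3 / 6 - (t ^+ 2 + 4) * w t / 6.

Let dH t : is_derive t (1 : R) H (1 - profile t).
Proof.
have p : 0 < t ^+ 2 + 4 by rewrite ltr_wpDl// sqr_ge0.
have dg : is_derive t (1 : R) (fun x : R => x ^+ 2 + 4) (2 * t).
  apply: is_derive_eq; rewrite /GRing.scale /=.
  by ring.
have dw : is_derive t (1 : R) w ((2 * w t)^-1 * (2 * t)).
  exact: (@is_derive1_comp R Num.sqrt (fun x => x ^+ 2 + 4) t _ _ (is_derive1_sqrt p) dg).
have gen (v : R -> R) (dv : R) : is_derive t (1 : R) v dv ->
    is_derive t (1 : R) (fun x : R => x + x ^+ 3 / 6 - (x ^+ 2 + 4) * v x / 6)
      (1 + t ^+ 2 / 2 - ((t ^+ 2 + 4) * dv + 2 * t * v t) / 6).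
  move=> ?; apply: is_derive_eq; rewrite /GRing.scale /=.
  by rewrite !mulr0 !add0r; field.
apply: is_derive_eq (gen _ _ dw) _.
rewrite -w_sq /profile; have := w_gt0 t; move: (w t) => y y0.
by field; rewrite gt_eqF.
Qed.

(** The right sum dominates the integral from [D] to [T = (N + 1) D]. The missing first cell costs
    at most [D], as the integrand is at most 1, and the missing tail at most [4 / (3 T)]. *)
Lemma sum_profile_ge (D : R) (N : nat) : 0 < D ->
  4 / 3 - D - 4 / (3 * (N.+1%:R * D)) <= \sum_(k < N) D * (1 - profile (k.+1%:R * D)).
Proof.
move=> D0; have D0' := ltW D0.
pose f t := 1 - profile t.
have fdec x y : 0 <= x -> x <= y -> f y <= f x.
  by move=> x0 xy; rewrite lerD2l lerN2 profile_nd.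
apply: (le_trans _ (right_sum_ge N dH fdec D0')).
have [_ HD] := le_increment dH fdec (lexx 0) D0'.
have H0 : H 0 = - (4 / 3).
  rewrite /H /w !expr0n /= (_ : 0 + 4 = 2 ^+ 2); last by ring.
  by rewrite sqrtr_sqr ger0_norm//; field.
have f0 : 1 - profile 0 = 1 by rewrite /profile expr0n /= !mul0r subrr mul0r subr0.
have T0 : 0 < N.+1%:R * D by rewrite mulr_gt0.
have HT : - (4 / (3 * (N.+1%:R * D))) <= H (N.+1%:R * D).
  move: (N.+1%:R * D) T0 => T T0.
  (* Tangent bound for the square root; substituted into [H T] it gives exactly [- 4 / (3 T)]. *)
  have wT : w T <= T + 2 / T.
    have ? : 0 <= T + 2 / T by rewrite addr_ge0 ?divr_ge0// ltW.
    rewrite -(ler_pXn2r (n := 2)) ?nnegrE ?(ltW (w_gt0 _))// w_sq.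
    rewrite (_ : (T + 2 / T) ^+ 2 = T ^+ 2 + 4 + (2 / T) ^+ 2).
      by rewrite lerDl sqr_ge0.
    by field; rewrite gt_eqF.
  have p : 0 < T ^+ 2 + 4 by rewrite ltr_wpDl// sqr_ge0.
  rewrite (_ : - (4 / (3 * T)) = T + T ^+ 3 / 6 - (T ^+ 2 + 4) * (T + 2 / T) / 6).
    by rewrite lerD2l lerN2 ler_wpM2r// ler_wpM2l// ltW.
  by field; rewrite gt_eqF.
move: HD HT; rewrite f0 mul1r subr0 H0.
by move: (H _) (H D) (4 / (3 * _)) => a b c HD HT; lra.
Qed.

(** At the node [t = (k + 1) D], [h k] exceeds the profile by at most [eps / t^2]; weighted by [D]
    and summed, this costs [eps / D] times a partial sum of inverse squares, which is at most 2. *)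
Lemma quadrature_ge (D eps : R) (N : nat) (h : 'I_N -> R) : 0 < D -> 0 <= eps ->
  (forall k, 0 <= h k) ->
  (forall k : 'I_N, h k ^+ 2 + (k.+1%:R * D) ^+ 2 * h k <= (k.+1%:R * D) ^+ 2 + eps) ->
  4 / 3 - D - 4 / (3 * (N.+1%:R * D)) - 2 * eps / D <= \sum_(k < N) D * (1 - h k).
Proof.
move=> D0 e0 h0 hE.
have hk (k : 'I_N) : D * (1 - profile (k.+1%:R * D)) - eps / D * (k.+1%:R ^+ 2)^-1
    <= D * (1 - h k).
  have tk0 : 0 < k.+1%:R * D by rewrite mulr_gt0.
  have -> : eps / D * (k.+1%:R ^+ 2)^-1 = D * (eps / (k.+1%:R * D) ^+ 2).
    by field; rewrite gt_eqF//= pnatr_eq0.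
  rewrite -mulrBr ler_wpM2l ?(ltW D0)// -addrA lerD2l -opprD lerN2.
  rewrite -lerBlDl; have := hE k; have := h0 k; have := profile_ge0 (ltW tk0).
  have := profileE (k.+1%:R * D); move: (profile _) (h k) => p h' pE p0 h'0 h'E.
  rewrite ler_pdivlMr ?exprn_gt0//.
  have := sqr_ge0 (k.+1%:R * D); move: ((k.+1%:R * D) ^+ 2) pE h'E => s pE h'E s0.
  (* If [h'] exceeds [p], then [p^2 <= h'^2], and subtracting the equation for [p] from the
     inequality for [h'] leaves [s (h' - p) <= eps]. *)
  case: (leP h' p) => [hp|/ltW hp].
    by rewrite (le_trans _ e0)// mulr_le0_ge0// subr_le0.
  have : p ^+ 2 <= h' ^+ 2 by apply: lerXn2r.
  rewrite mulrBl mulrC (mulrC p); lra.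
apply: (le_trans _ (ler_sum _ (fun k _ => hk k))).
rewrite sumrB -[X in _ <= _ - X]mulr_sumr lerB ?sum_profile_ge//.
rewrite -[leRHS]mulrA [leRHS]mulrC ler_wpM2l ?divr_ge0 ?(ltW D0)//.
exact: sum_inv_sq_le.
Qed.

End Quadrature.

(** * Lower bound for the mean nuclear norm *)

(* No measurability is assumed: [spectral_diag] is obtained by choice, and we avoid
   proving that [sum_singular_values] is measurable. *)
Lemma ge0_le_integral_any d (T : measurableType d) (R : realType)
  (mu : {measure set T -> \bar R}) (f g : T -> \bar R) :
  (forall x, 0 <= f x)%E -> (forall x, f x <= g x)%E ->
  (\int[mu]_x f x <= \int[mu]_x g x)%E.
Proof.
move=> f0 fg; have g0 x : (0 <= g x)%E by exact: le_trans (fg x).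
rewrite !ge0_integralTE//; apply: ge_ereal_sup => _ [h /= hf <-].
apply: ereal_sup_ubound; exists h => //= x.
exact: le_trans (fg x).
Qed.

Section BoundedExpectation.
Context d (T : measurableType d) (R : realType) (P : probability T R).

Lemma integrable_bounded (f : T -> R) (c : R) :
  measurable_fun setT f -> (forall w, `|f w| <= c) ->
  P.-integrable setT (EFin \o f).
Proof.
move=> mf fc; apply: (@le_integrable _ _ _ _ _ measurableT _ (fun w => c%:E)).
- exact/measurable_EFinP.
- by move=> w _; rewrite /= lee_fin (le_trans (fc w))// ler_norm.
- exact: finite_measure_integrable_cst.
Qed.

(** Nonnegativity of the variance, by expanding [(f - h)^2]. *)
Lemma sqr_expectation_le (f : T -> R) (c h q : R) :
  measurable_fun setT f -> (forall w, `|f w| <= c) ->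
  (\int[P]_w (f w)%:E = h%:E)%E -> (\int[P]_w (f w ^+ 2)%:E = q%:E)%E ->
  h ^+ 2 <= q.
Proof.
move=> mf fc fh fq.
have intf := integrable_bounded mf fc.
have mf2 : measurable_fun setT (fun w => f w ^+ 2) by exact: measurable_funX.
have intf2 : P.-integrable setT (EFin \o (fun w => f w ^+ 2)).
  apply: (@integrable_bounded _ (c ^+ 2)) => // w.
  by rewrite normrX lerXn2r ?nnegrE// (le_trans (normr_ge0 (f w))).
have E : (\int[P]_w ((f w - h) ^+ 2)%:E = (q - h ^+ 2)%:E)%E.
  transitivity (\int[P]_w ((f w ^+ 2)%:E + ((- 2 * h)%:E * (f w)%:E + (h ^+ 2)%:E)))%E.
    by apply: eq_integral => w _; rewrite -EFinM -!EFinD; congr EFin; ring.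
  have int1 : P.-integrable setT (fun w => (- 2 * h)%:E * (f w)%:E)%E.
    exact: integrableZl intf.
  have int0 : P.-integrable setT (fun w => (h ^+ 2)%:E).
    exact: finite_measure_integrable_cst.
  rewrite integralD//; last exact: integrableD.
  rewrite integralD// integralZl// fq fh integral_cst//.
  rewrite [X in (_ + (_ + _ * X))%E](_ : _ = 1%E) ?mule1; last exact: probability_setT.
  by rewrite -EFinM -!EFinD; congr EFin; ring.
rewrite -subr_ge0 -lee_fin -E integral_ge0// => w _.
by rewrite lee_fin sqr_ge0.
Qed.

Lemma integrable_affine (a b : R) (g : T -> R) : P.-integrable setT (EFin \o g) ->
  P.-integrable setT (fun w => (a * g w + b)%:E).
Proof.
move=> ig; under eq_fun do rewrite EFinD EFinM.
apply: integrableD => //; first exact: integrableZl ig.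
exact: finite_measure_integrable_cst.
Qed.

Lemma integral_affine (a b : R) (g : T -> R) (r : R) :
  P.-integrable setT (EFin \o g) -> (\int[P]_w (g w)%:E = r%:E)%E ->
  (\int[P]_w (a * g w + b)%:E = (a * r + b)%:E)%E.
Proof.
move=> ig gr; under eq_integral do rewrite EFinD EFinM.
rewrite integralD//; [|exact: integrableZl ig|exact: finite_measure_integrable_cst].
rewrite integralZl// gr integral_cst//.
rewrite [X in (_ + _ * X)%E](_ : _ = 1%E) ?mule1; last exact: probability_setT.
by rewrite -EFinM -EFinD.
Qed.

End BoundedExpectation.

Section MeanBound.
Context {R : realType} {n : nat} {I : finType} (E : I -> 'M[R[i]]_n).
Context d (T : measurableType d) (P : probability T R).
Context (X : I -> {RV P >-> R}) (s eps : R).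
Hypothesis n0 : (0 < n)%N.
Hypothesis s0 : 0 < s.
Hypothesis indX : mutually_independent P (fun i => (X i : T -> R)).
Hypothesis lawX : forall k, has_normal_law P (X k) 0 s.
Hypothesis eps0 : 0 <= eps.

Let XX (w : T) : vect I R := fun i => X i w.

Definition mean_resolvent (t : R) (Z : 'M[R[i]]_n) : R :=
  n%:R^-1 * \sum_j t ^+ 2 / (t ^+ 2 + gram_eig Z j).

(** Here the ensembles differ: [eps = 0] in the complex case and [eps = 1 / n] in the real one. *)
Hypothesis coord_trace_deriv_ge : forall t x, 0 < t ->
  2 * n%:R / t ^+ 2 * (mean_resolvent t (linear_mx E x) ^+ 2 - eps) <=
  s ^+ 2 * \sum_k coord_trace_deriv E t k x.

Let np : (0 : R) < n%:R. Proof. by rewrite ltr0n. Qed.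

Lemma mean_resolvent_itv t (Z : 'M[R[i]]_n) : 0 < t -> 0 <= mean_resolvent t Z <= 1.
Proof.
move=> t0; have t2 : 0 < t ^+ 2 by rewrite exprn_gt0.
have den j : 0 < t ^+ 2 + gram_eig Z j by rewrite ltr_wpDr// gram_eig_ge0.
apply/andP; split.
  by rewrite mulr_ge0 ?invr_ge0 ?(ltW np)// sumr_ge0// => j _; rewrite divr_ge0// ltW.
rewrite /mean_resolvent mulrC ler_pdivrMr// mul1r.
rewrite -[X in X%:R]card_ord -sumr_const ler_sum// => j _.
by rewrite ler_pdivrMr// mul1r lerDl gram_eig_ge0.
Qed.

Lemma trace_resolventE t Z : 0 < t -> 2 * t * trace_resolvent t Z = 2 * n%:R * mean_resolvent t Z.
Proof.
move=> t0; rewrite /mean_resolvent /trace_resolvent !mulr_sumr; apply: eq_bigr => j _.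
by rewrite !mulrA (mulfK (lt0r_neq0 np)) -(mulrA 2 t) -expr2.
Qed.

Let mXX : measurable_fun setT XX.
Proof. by apply: measurable_vect => i; exact: measurable_funP. Qed.

(** The eigenvalues come from a choice of diagonalization, so measurability is read off
    [sum_coord_trace], which expresses the same quantity through entries of the resolvent. *)
Lemma measurable_mean_resolvent t : 0 < t ->
  measurable_fun setT (fun w => mean_resolvent t (linear_mx E (XX w))).
Proof.
move=> t0.
have -> : (fun w => mean_resolvent t (linear_mx E (XX w))) =
    (fun w => 1 - (2 * n%:R)^-1 * \sum_k XX w k * coord_trace E t k (XX w)).
  apply/funext => w; rewrite sum_coord_trace// trace_resolventE//.
  by field; rewrite lt0r_neq0.
apply: measurable_funB => //; apply: measurable_funM => //.
apply: measurable_sum => k; apply: measurable_funM.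
  exact: measurable_funP.
by apply: measurableT_comp => //; exact: measurable_coord_trace.
Qed.

Let mean_resolvent_norm t w : 0 < t -> `|mean_resolvent t (linear_mx E (XX w))| <= 1.
Proof. by move=> t0; case/andP: (mean_resolvent_itv (linear_mx E (XX w)) t0) => ? ?; rewrite ger0_norm. Qed.

Lemma expectation_mean_resolvent t : 0 < t -> exists h : R,
  [/\ (\int[P]_w (mean_resolvent t (linear_mx E (XX w)))%:E = h%:E)%E, 0 <= h &
     h ^+ 2 + t ^+ 2 * h <= t ^+ 2 + eps].
Proof.
move=> t0; pose f w := mean_resolvent t (linear_mx E (XX w)).
have mf : measurable_fun setT f by exact: measurable_mean_resolvent.
have f1 w : `|f w| <= 1 by exact: mean_resolvent_norm.
have intf := integrable_bounded P mf f1.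
have mf2 : measurable_fun setT (fun w => f w ^+ 2) by exact: measurable_funX.
have intf2 : P.-integrable setT (EFin \o (fun w => f w ^+ 2)).
  by apply: (@integrable_bounded _ _ _ _ _ 1) => // w; rewrite normrX exprn_ile1.
pose h := fine (\int[P]_w (f w)%:E); pose q := fine (\int[P]_w (f w ^+ 2)%:E).
have hE : (\int[P]_w (f w)%:E = h%:E)%E by rewrite fineK//; exact: integrable_fin_num intf.
have qE : (\int[P]_w (f w ^+ 2)%:E = q%:E)%E.
  by rewrite fineK//; exact: integrable_fin_num intf2.
have hq : h ^+ 2 <= q by exact: sqr_expectation_le mf f1 hE qE.
exists h; split => //.
  rewrite -lee_fin -hE integral_ge0// => w _; rewrite lee_fin.
  by case/andP: (mean_resolvent_itv (linear_mx E (XX w)) t0).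
have c0 : 0 < 2 * n%:R / t ^+ 2 by rewrite divr_gt0 ?mulr_gt0// exprn_gt0.
(* In expectation, [2 n / t^2 (q - eps) <= 2 n (1 - h)]: the lower bound on the derivatives meets
   the Stein identity. Jensen, [h^2 <= q], then closes the inequality in [h]. *)
have : (\int[P]_w (2 * n%:R / t ^+ 2 * f w ^+ 2 + - (2 * n%:R / t ^+ 2 * eps))%:E <=
        \int[P]_w (- (2 * n%:R) * f w + 2 * n%:R)%:E)%E.
  rewrite [leRHS](_ : _ = \int[P]_w (s ^+ 2 * \sum_k coord_trace_deriv E t k (XX w))%:E)%E; last first.
    rewrite -(expectation_trace_resolvent E t0 s0 indX lawX).
    by apply: eq_integral => w _; rewrite trace_resolventE// mulNr addrC.
  apply: le_integral => //.
  - exact: integrable_affine intf2.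
  - exact: integrable_sum_coord_trace_deriv.
  - by move=> w _; rewrite lee_fin -mulrBr; exact: coord_trace_deriv_ge.
rewrite (integral_affine _ _ intf2 qE) (integral_affine _ _ intf hE) lee_fin => main.
have {}main : q - eps <= t ^+ 2 * (1 - h).
  rewrite -(ler_pM2l c0).
  have -> : 2 * n%:R / t ^+ 2 * (t ^+ 2 * (1 - h)) = - (2 * n%:R) * h + 2 * n%:R.
    by field; rewrite gt_eqF.
  by rewrite mulrBr.
by move: hq main; rewrite mulrBr mulr1; move: (t ^+ 2 * h) => th hq main; lra.
Qed.

Lemma sum_singular_valuesE (Z : 'M[R[i]]_n) :
  sum_singular_values Z = \sum_j Num.sqrt (gram_eig Z j).
Proof. by apply: eq_bigr => j _; rewrite /singular_values mxE. Qed.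

Lemma right_sum_le_nuclear (Z : 'M[R[i]]_n) (D : R) (N : nat) : 0 < D ->
  2 / pi * \sum_(k < N) D * (1 - mean_resolvent (k.+1%:R * D) Z) <=
  n%:R^-1 * sum_singular_values Z.
Proof.
move=> D0; rewrite sum_singular_valuesE.
have pi2 : (0 : R) < pi / 2 by rewrite divr_gt0// pi_gt0.
have c1 : pi / 2 * (2 / pi) = 1 :> R.
  by rewrite mulrA divfK ?pnatr_eq0// divff// lt0r_neq0// pi_gt0.
rewrite -(ler_pM2l pi2) mulrA c1 mul1r mulrCA mulr_sumr.
have -> : \sum_(k < N) D * (1 - mean_resolvent (k.+1%:R * D) Z) = n%:R^-1 *
   \sum_j \sum_(k < N) D * (1 - (k.+1%:R * D) ^+ 2 / ((k.+1%:R * D) ^+ 2 + gram_eig Z j)).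
  rewrite exchange_big mulr_sumr; apply: eq_bigr => k _ /=.
  rewrite -mulr_sumr mulrCA; congr (_ * _).
  by rewrite sumrB sumr_const card_ord mulrBr mulVf ?lt0r_neq0.
rewrite ler_wpM2l ?invr_ge0 ?(ltW np)// ler_sum// => j _.
by apply: sqrt_ge_right_sum; rewrite ?gram_eig_ge0// ltW.
Qed.

(** The Riemann sum is finite, so expectation passes inside, and the expected values at the nodes
    satisfy the hypotheses of [quadrature_ge]. *)
Lemma mean_nuclear_ge (D : R) (N : nat) : 0 < D ->
  ((2 / pi * (4 / 3 - D - 4 / (3 * (N.+1%:R * D)) - 2 * eps / D))%:E <=
   \int[P]_w (n%:R^-1 * sum_singular_values (linear_mx E (XX w)))%:E)%E.
Proof.
move=> D0.
have tk0 (k : 'I_N) : 0 < k.+1%:R * D by rewrite mulr_gt0.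
pose h k := sval (cid (expectation_mean_resolvent (tk0 k))).
have hP (k : 'I_N) : [/\
    (\int[P]_w (mean_resolvent (k.+1%:R * D) (linear_mx E (XX w)))%:E = (h k)%:E)%E,
    0 <= h k &
    h k ^+ 2 + (k.+1%:R * D) ^+ 2 * h k <= (k.+1%:R * D) ^+ 2 + eps].
  exact: svalP (cid (expectation_mean_resolvent (tk0 k))).
pose g w := \sum_(k < N) D * (1 - mean_resolvent (k.+1%:R * D) (linear_mx E (XX w))).
have pi2 : (0 : R) <= 2 / pi by rewrite divr_ge0// pi_ge0.
have g0 w : 0 <= g w.
  rewrite sumr_ge0// => k _; rewrite mulr_ge0 ?(ltW D0)// subr_ge0.
  by case/andP: (mean_resolvent_itv (linear_mx E (XX w)) (tk0 k)).
apply: (@le_trans _ _ (\int[P]_w (2 / pi * g w)%:E)%E); last first.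
  apply: ge0_le_integral_any => w; rewrite lee_fin; first by rewrite mulr_ge0.
  exact: right_sum_le_nuclear.
have inte k : P.-integrable setT
    (EFin \o (fun w => mean_resolvent (k.+1%:R * D) (linear_mx E (XX w)))).
  have tk : 0 < k.+1%:R * D by rewrite mulr_gt0.
  exact: (integrable_bounded _ (measurable_mean_resolvent tk) (fun w => mean_resolvent_norm w tk)).
rewrite (_ : (\int[P]_w _)%E = (2 / pi * \sum_(k < N) D * (1 - h k))%:E); last first.
  pose c := 2 / pi * D.
  have gE w : (2 / pi * g w)%:E =
      (\sum_(k < N) (- c * mean_resolvent (k.+1%:R * D) (linear_mx E (XX w)) + c)%:E)%E.
    rewrite sumEFin /g mulr_sumr; congr EFin; apply: eq_bigr => k _.
    by rewrite /c; ring.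
  under eq_integral do rewrite gE.
  rewrite integral_sum//; last by move=> k; exact: (integrable_affine _ _ (inte k)).
  rewrite mulr_sumr -sumEFin; apply: eq_bigr => k _.
  have [hk _ _] := hP k.
  by rewrite (integral_affine _ _ (inte k) hk) /c; congr EFin; ring.
rewrite lee_fin ler_wpM2l//; apply: quadrature_ge => // k; first by case: (hP k).
by case: (hP k).
Qed.

End MeanBound.

(** * The real and complex Ginibre ensembles as instances *)

Section Instances.
Context {R : realType} {n : nat}.
Hypothesis n0 : (0 < n)%N.
Local Notation C := R[i].
Local Open Scope complex_scope.

Definition real_dir (k : 'I_n * 'I_n) : 'M[C]_n := delta_mx k.1 k.2.
Definition complex_dir (k : bool * ('I_n * 'I_n)) : 'M[C]_n :=
  (if k.1 then 1 else 'i) *: delta_mx k.2.1 k.2.2.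

Let np : (0 : R) < n%:R. Proof. by rewrite ltr0n. Qed.

Let tauE (t : R) (Z : 'M[C]_n) : 0 < t -> trace_resolvent t Z = n%:R * mean_resolvent t Z / t.
Proof.
move=> t0; apply: (@mulfI _ (2 * t)); first by rewrite mulf_neq0// gt_eqF.
rewrite trace_resolventE//.
by field; rewrite gt_eqF.
Qed.

Lemma real_coord_trace_deriv_ge (t : R) (x : 'I_n * 'I_n -> R) : 0 < t ->
  2 * n%:R / t ^+ 2 * (mean_resolvent t (linear_mx real_dir x) ^+ 2 - n%:R^-1) <=
  Num.sqrt (n%:R^-1) ^+ 2 * \sum_k coord_trace_deriv real_dir t k x.
Proof.
move=> t0; rewrite sqr_sqrtr ?invr_ge0 ?(ltW np)//.
have [tu td] := tr_resolvent real_dir t0 x.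
have := sum_dir_trace_deriv_real tu td (resolvent_col_le t0 (dilation_skew _ _) (resolventP _ t0 x)).
rewrite -(ler_pM2l (_ : 0 < n%:R^-1)) ?invr_gt0//; apply: le_trans.
rewrite tauE// le_eqVlt; apply/orP; left; apply/eqP.
by field; rewrite !gt_eqF.
Qed.

Lemma complex_coord_trace_deriv_ge (t : R) (x : bool * ('I_n * 'I_n) -> R) : 0 < t ->
  2 * n%:R / t ^+ 2 * (mean_resolvent t (linear_mx complex_dir x) ^+ 2 - 0) <=
  Num.sqrt (n%:R^-1 / 2) ^+ 2 * \sum_k coord_trace_deriv complex_dir t k x.
Proof.
move=> t0; rewrite sqr_sqrtr ?divr_ge0 ?invr_ge0 ?(ltW np)//.
have [tu td] := tr_resolvent complex_dir t0 x.
rewrite [X in _ <= _ * X](sum_dir_trace_deriv_complex tu td) tauE//.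
rewrite le_eqVlt; apply/orP; left; apply/eqP.
by field; rewrite !gt_eqF.
Qed.

Lemma linear_mx_real (x : 'I_n * 'I_n -> R) :
  linear_mx real_dir x = complexify (\matrix_(i, j) x (i, j)).
Proof.
apply/matrixP => i j; rewrite /linear_mx summxE !mxE (bigD1 (i, j))//= big1 ?addr0.
  by rewrite !mxE !eqxx mulr1.
move=> [i' j'] ij; rewrite !mxE /=.
have -> : (i == i') && (j == j') = false.
  by apply/negbTE; apply: contra ij => /andP[/eqP-> /eqP->].
by rewrite mulr0.
Qed.

Lemma linear_mx_complex (x : bool * ('I_n * 'I_n) -> R) :
  linear_mx complex_dir x = \matrix_(i, j) Complex (x (true, (i, j))) (x (false, (i, j))).
Proof.
apply/matrixP => i j; rewrite /linear_mx summxE mxE.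
rewrite (bigD1 (true, (i, j)))//= (bigD1 (false, (i, j)))//= big1 ?addr0.
  rewrite !mxE /= !eqxx !mulr1; congr Complex => /=; ring.
move=> [b [i' j']] /andP[ijt ijf]; rewrite !mxE /=.
have -> : (i == i') && (j == j') = false.
  apply/negbTE/negP => /andP[/eqP ii /eqP jj]; move: ijt ijf.
  by rewrite ii jj; case: b; rewrite eqxx.
by rewrite !mulr0.
Qed.

End Instances.

Theorem theorem3 (R : realType) (d : nat) (hd : (1 <= d)%N) :
  (* complex Ginibre: entries z_ij = X_ij + i Y_ij with all 2d^2 real parts
     i.i.d. N(0, 1/(2d)), i.e. circularly symmetric with E|z_ij|^2 = 1/d *)
  (forall (dT : measure_display) (T : measurableType dT) (P : probability T R)
          (X Y : 'I_d -> 'I_d -> {RV P >-> R}),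
     mutually_independent P
       (fun k : bool * ('I_d * 'I_d) =>
          if k.1 then (X k.2.1 k.2.2 : T -> R) else (Y k.2.1 k.2.2 : T -> R)) ->
     (forall i j, has_normal_law P (X i j) 0 (Num.sqrt ((d%:R)^-1 / 2))) ->
     (forall i j, has_normal_law P (Y i j) 0 (Num.sqrt ((d%:R)^-1 / 2))) ->
     ((8 / (3 * pi) - 4 / d%:R)%:E <=
        'E_P[(fun w => (d%:R)^-1 *
               sum_singular_values (\matrix_(i, j) Complex (X i j w) (Y i j w)))%R])%E)
  /\
  (* real Ginibre: entries i.i.d. N(0, 1/d) *)
  (forall (dT : measure_display) (T : measurableType dT) (P : probability T R)
          (X : 'I_d -> 'I_d -> {RV P >-> R}),
     mutually_independent P (fun k : 'I_d * 'I_d => (X k.1 k.2 : T -> R)) ->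
     (forall i j, has_normal_law P (X i j) 0 (Num.sqrt ((d%:R)^-1))) ->
     ((8 / (3 * pi) - 3 * Num.sqrt ((d%:R)^-1) - 4 / d%:R)%:E <=
        'E_P[(fun w => (d%:R)^-1 *
               sum_singular_values (complexify (\matrix_(i, j) X i j w)))%R])%E).
Proof.
have dp : (0 : R) < d%:R by rewrite ltr0n.
have pi0 : (0 : R) < pi by exact: pi_gt0.
have pi2 : 2 / pi <= 1 :> R by rewrite ler_pdivrMr// mul1r pi_ge2.
have pi20 : 0 <= 2 / pi :> R by rewrite divr_ge0// ltW.
(* As [2 / pi <= 1], errors subtracted inside the bracket do not grow, while the main term becomes
   [8 / (3 pi)]. *)
have fin (L x : R) : 0 <= x -> x <= L -> 8 / (3 * pi) - L <= 2 / pi * (4 / 3 - x).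
  move=> x0 xL; rewrite mulrBr (_ : 2 / pi * (4 / 3) = 8 / (3 * pi)).
    by rewrite lerD2l lerN2 (le_trans _ xL)// ler_piMl.
  move: (pi : R) (lt0r_neq0 pi0) => p pn0.
  by field; exact: pn0.
(* With [d^2] nodes and step at least [1 / d], the cut-off is beyond [d], so the truncated tail is
   of order [1 / d]. *)
have tail (D : R) : d%:R^-1 <= D ->
    0 <= 4 / (3 * ((d ^ 2).+1%:R * D)) <= 2 * d%:R^-1.
  move=> dD; have D0 : 0 < D by rewrite (lt_le_trans _ dD)// invr_gt0.
  have dT : d%:R <= (d ^ 2).+1%:R * D.
    apply: (@le_trans _ _ ((d ^ 2)%:R * d%:R^-1)).
      by rewrite natrX expr2 mulfK// gt_eqF.
    by rewrite ler_pM// ?invr_ge0 ?(ltW dp)// ler_nat.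
  have T0 := lt_le_trans dp dT.
  move: (_ * D) T0 dT => t T0 dT.
  rewrite divr_ge0 ?mulr_ge0 ?(ltW T0)//=.
  have -> : 2 * d%:R^-1 = 4 / (2 * d%:R) :> R by field; rewrite gt_eqF.
  rewrite ler_pM2l// lef_pV2 ?posrE ?mulr_gt0//.
  by rewrite ler_pM ?(ltW dp)// ler_nat.
split=> dT T P X.
- move=> Y indXY lawX lawY.
  pose V (k : bool * ('I_d * 'I_d)) : {RV P >-> R} :=
    if k.1 then X k.2.1 k.2.2 else Y k.2.1 k.2.2.
  have indV : mutually_independent P (fun k => (V k : T -> R)).
    by rewrite (_ : (fun k => _) = (fun k : bool * ('I_d * 'I_d) =>
      if k.1 then (X k.2.1 k.2.2 : T -> R) else (Y k.2.1 k.2.2 : T -> R)))//;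
      apply/funext => -[[] ?].
  have lawV k : has_normal_law P (V k) 0 (Num.sqrt (d%:R^-1 / 2)).
    by case: k => -[] [i j]; [exact: lawX|exact: lawY].
  have s0 : (0 : R) < Num.sqrt (d%:R^-1 / 2) by rewrite sqrtr_gt0 divr_gt0 ?invr_gt0.
  have D0 : (0 : R) < d%:R^-1 by rewrite invr_gt0.
  (* Step [1 / d] with [eps = 0]: the first cell and the tail cost at most [3 / d] together. *)
  have := mean_nuclear_ge hd s0 indV lawV (lexx 0) (complex_coord_trace_deriv_ge hd) (d ^ 2) D0.
  rewrite unlock; under eq_integral do rewrite linear_mx_complex.
  apply: le_trans; rewrite lee_fin.
  have /andP[A0 A1] := tail _ (lexx _).
  rewrite mulr0 mul0r subr0 -addrA -opprD; apply: fin.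
    by rewrite addr_ge0 ?(ltW D0).
  rewrite (le_trans (lerD (lexx _) A1))//.
  have -> : d%:R^-1 + 2 * d%:R^-1 = 3 * d%:R^-1 :> R by ring.
  by rewrite ler_wpM2r ?ler_nat// ltW.
- move=> indX lawX.
  pose V (k : 'I_d * 'I_d) : {RV P >-> R} := X k.1 k.2.
  have s0 : (0 : R) < Num.sqrt (d%:R^-1) by rewrite sqrtr_gt0 invr_gt0.
  have e0 : (0 : R) <= d%:R^-1 by rewrite invr_ge0 ltW.
  (* The step is [1 / sqrt d], equal to the standard deviation, so [s0] also serves as its
     positivity. It balances the first cell, [D], against [2 eps / D] with [eps = 1 / d], for a
     total of [3 / sqrt d]. *)
  have := @mean_nuclear_ge _ _ _ _ _ _ _ V _ _ hd s0 indX (fun k => lawX k.1 k.2)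
    e0 (real_coord_trace_deriv_ge hd) _ (d ^ 2) s0.
  rewrite unlock; under eq_integral do rewrite linear_mx_real.
  apply: le_trans; rewrite lee_fin.
  have uD : d%:R^-1 <= Num.sqrt d%:R^-1 :> R.
    rewrite -[leLHS]sqr_sqrtr// expr2 ler_piMl// -[leRHS]sqrtr1.
    by rewrite ler_wsqrtr// invf_le1// ler1n.
  have /andP[A0 A1] := tail _ uD.
  have -> : 2 * d%:R^-1 / Num.sqrt d%:R^-1 = 2 * Num.sqrt d%:R^-1 :> R.
    rewrite -[X in 2 * X / _](sqr_sqrtr e0) expr2 mulrA mulfK//.
    exact: lt0r_neq0.
  move: A0 A1 s0 uD.
  have -> : 8 / (3 * pi) - 3 * Num.sqrt d%:R^-1 - 4 / d%:R =
      8 / (3 * pi) - (3 * Num.sqrt d%:R^-1 + 4 / d%:R) :> R by ring.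
  move: (Num.sqrt _) => r; move: (4 / (3 * ((d ^ 2).+1%:R * r)) : R) => A A0 A1 r0 uD.
  rewrite (_ : 4 / 3 - r - A - 2 * r = 4 / 3 - (3 * r + A)); last by ring.
  apply: fin; first by rewrite addr_ge0 ?mulr_ge0// ltW.
  by rewrite lerD2l (le_trans A1)// ler_wpM2r// ?invr_ge0 ?ler_nat// ltW.
Qed.
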